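(* Let $0<d\le 1/2$ be fixed. (1) If $p=\omega(n^{-2/3})$, then for every sequence $(G_n)$ with $G_n\in\mathscr{G}_{d,n}$, asymptotically almost surely $G_n\cup\mathbb{G}(n,p)\xrightarrow{\mathrm{rbw}}K_6$. (2) For every fixed $\varepsilon>0$, if $p=n^{-(2/3+\varepsilon)}$, then there is a sequence $(G_n)$ with $G_n\in\mathscr{G}_{d,n}$ such that asymptotically almost surely $G_n\cup\mathbb{G}(n,p)$ does not satisfy $\xrightarrow{\mathrm{rbw}}K_6$.
   Context: For graphs $G,H$, write $G \xrightarrow{\mathrm{rbw}} H$ if every proper edge-colouring of $G$ contains a rainbow copy of $H$ (a subgraph all of whose edges receive distinct colours). $\mathbb{G}(n,p)$ is the binomial random graph. $\mathscr{G}_{d,n}$ denotes the family of $n$-vertex graphs with edge density at least $d$. $G\cup\mathbb{G}(n,p)$ denotes the union of a fixed $n$-vertex graph $G$ with an independent random graph $\mathbb{G}(n,p)$ on the same vertex set. ''Asymptotically almost surely'' means with probability tending to $1$ as $n\to\infty$. *)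

(* Defs.v *)
From HB Require Import structures.
From mathcomp Require Import all_boot all_order all_algebra.
From mathcomp Require Import all_classical all_reals all_analysis.

Set Implicit Arguments.
Unset Strict Implicit.
Unset Printing Implicit Defensive.

Import Order.TTheory GRing.Theory Num.Theory.
Local Open Scope ring_scope.

Definition pairs (n : nat) : {set {set 'I_n}} := [set e : {set 'I_n} | #|e| == 2]%N.

Definition is_graph (n : nat) (G : {set {set 'I_n}}) : Prop := G \subset pairs n.

Definition dense_graph (R : realType) (d : R) (n : nat) (G : {set {set 'I_n}}) : Prop :=
  is_graph G /\ d * ('C(n, 2))%:R <= (#|G|)%:R.

Definition proper_colouring (n : nat) (G : {set {set 'I_n}}) (c : {set 'I_n} -> nat) : Prop :=
  forall e f, e \in G -> f \in G -> e != f -> ~~ [disjoint e & f] -> c e != c f.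

Definition has_rainbow_K6 (n : nat) (G : {set {set 'I_n}}) (c : {set 'I_n} -> nat) : Prop :=
  exists S : {set 'I_n}, #|S| = 6%N /\
    (forall e : {set 'I_n}, e \subset S -> #|e| = 2%N -> e \in G) /\
    {in [set e : {set 'I_n} | (e \subset S) && (#|e| == 2)%N] &, injective c}.

Definition rbw_K6 (n : nat) (G : {set {set 'I_n}}) : Prop :=
  forall c, proper_colouring G c -> has_rainbow_K6 G c.

(* The binomial random graph G(n,p): probability that G(n,p) satisfies Q,
   each of the binom(n,2) possible edges being present independently with
   probability p. *)
Definition Gnp_prob (R : realType) (n : nat) (p : R) (Q : {set {set 'I_n}} -> Prop) : R :=
  \sum_(H : {set {set 'I_n}} | (H \subset pairs n) && `[< Q H >])
     p ^+ #|H| * (1 - p) ^+ (#|pairs n| - #|H|).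

(* Main.v *)
(** Part (1). Count the pairs (t, x) of vertex triples such that t and x span triangles of
    the random graph H while all nine edges between them lie in G. A dense G has at least
    c n^6 candidate pairs, so by Chebyshev's inequality there are of order mu^2 pairs, where
    mu = n^3 p^3. If a proper colouring has no rainbow K_6, each such pair has two disjoint
    edges of the same colour. Fixing one of the triangles, properness leaves for the other
    one either at most n possible positions of one of its edges, or one possible position of
    one of its vertices. Triangles of H are spread evenly over edges and over vertices (this
    is measured by the numbers of pairs of triangles sharing an edge, or a vertex), so once
    n^2 p^3 is large only a small proportion of the mu^2 pairs can be spoiled.

    Part (2). Let G be a balanced complete bipartite graph. A first moment computation shows
    that in H every small vertex set S spans fewer than 3|S|/2 edges, and that clusters of
    triangles are of bounded size. Growing the clusters triangle by triangle, one lists the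
    vertices in a sequence in which every triangle of H has two consecutive vertices. Colour
    an edge ab between the two sides by f(a) + f(b), with f the position in the list, and give
    all other edges private colours. There being no K_4 in H, a K_6 consists of a triangle of
    H on each side; if a, a' and b, b' are consecutive vertices of these two triangles then ab'
    and a'b have the same colour. *)

Require Import Defs.
From HB Require Import structures.
From mathcomp Require Import all_boot all_order all_algebra zify.
From mathcomp Require boolp.

Set Implicit Arguments.
Unset Strict Implicit.
Unset Printing Implicit Defensive.

(** * Covering the triangles of a sparse graph by a sequence of vertices *)

Definition consec (V : Type) (s : seq V) u w := exists s1 s2, s = s1 ++ u :: w :: s2.

Definition flatM (V : Type) (M : seq (V * V)) := flatten [seq [:: q.1; q.2] | q <- M].

Lemma flatM_cons (V : Type) q (M : seq (V * V)) : flatM (q :: M) = [:: q.1, q.2 & flatM M].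
Proof. by []. Qed.

Lemma consec_catl (V : Type) (s s' : seq V) u w : consec s u w -> consec (s ++ s') u w.
Proof. by case=> s1 [s2 ->]; exists s1, (s2 ++ s'); rewrite -catA. Qed.

Lemma consec_catr (V : Type) (s s' : seq V) u w : consec s u w -> consec (s' ++ s) u w.
Proof. by case=> s1 [s2 ->]; exists (s' ++ s1), s2; rewrite -catA. Qed.

Lemma flatM_cat (V : Type) (M1 M2 : seq (V * V)) : flatM (M1 ++ M2) = flatM M1 ++ flatM M2.
Proof. by rewrite /flatM map_cat flatten_cat. Qed.

Lemma consec_flatM (V : eqType) (M : seq (V * V)) q : q \in M -> consec (flatM M) q.1 q.2.
Proof.
case/path.splitPr=> M1 M2.
by exists (flatM M1); exists (flatM M2); rewrite flatM_cat flatM_cons.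
Qed.

Lemma flatMP (V : eqType) (M : seq (V * V)) x : reflect (exists2 q, q \in M & (x == q.1) || (x == q.2)) (x \in flatM M).
Proof.
apply: (iffP flatten_mapP) => [[q qM]|[q qM xq]]; first by rewrite !inE => xq; exists q.
by exists q => //; rewrite !inE.
Qed.

Section TriangleCover.
Variables (V : finType) (adj : rel V).
Hypotheses (adj_sym : symmetric adj) (adj_irr : irreflexive adj).
Implicit Types (S T W : {set V}) (s : seq V) (M : seq (V * V)).

Definition clique T := forall x y, x \in T -> y \in T -> x != y -> adj x y.
Definition triangle T := #|T| = 3 /\ clique T.
(** Ordered pairs are counted, so this is twice the number of edges spanned by [S]. Sparseness,
    fewer than 3|S|/2 edges, becomes [arcs S < 3 * #|S|]. *)
Definition arcs S := (\sum_(x in S) \sum_(y in S) adj x y)%N.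
Definition nbrs v S := [set y in S | adj v y].

Lemma arcsU1 v S : v \notin S -> arcs (v |: S) = (arcs S + #|nbrs v S|.*2)%N.
Proof.
move=> vS; rewrite /arcs big_setU1 //= big_setU1 //= adj_irr add0n.
have -> : \sum_(x in S) \sum_(y in v |: S) adj x y =
          (\sum_(x in S) adj v x + \sum_(x in S) \sum_(y in S) adj x y)%N.
  by rewrite -big_split /=; apply: eq_bigr => x _; rewrite big_setU1 //= adj_sym.
have -> : (\sum_(x in S) adj v x = #|nbrs v S|)%N.
  by rewrite -sum1_card big_mkcond /= [RHS]big_mkcond /=; apply: eq_bigr => x _; rewrite inE; case: (x \in S) => //=; case: adj.
by lia.
Qed.

(** The pairs are disjoint blocks that can be moved apart freely, which leaves room to insert a
    further vertex; a mere sequence cover has no such freedom. *)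
Definition pair_cover S M := [/\ uniq (flatM M), {subset flatM M <= S} &
  forall T, triangle T -> T \subset S -> exists2 q, q \in M & (q.1 \in T) && (q.2 \in T)].

Definition seq_cover S s := [/\ uniq s, {subset s <= S} &
  forall T, triangle T -> T \subset S -> exists u w, [/\ u \in T, w \in T & consec s u w]].

Lemma pair_seq_cover S M : pair_cover S M -> seq_cover S (flatM M).
Proof.
case=> uM sM cM; split=> // T tT TS.
have [q qM /andP[q1 q2]] := cM T tT TS.
by exists q.1, q.2; split => //; apply: consec_flatM.
Qed.

(* Splicing v next to a into the pairs only breaks adjacencies between different pairs. *)
Lemma pair_cover_splice S M v a b : pair_cover S M -> v \notin S -> a \in S ->
  (forall T, triangle T -> T \subset v |: S -> v \in T -> T = v |: [set a; b]) ->
  exists s, seq_cover (v |: S) s.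
Proof.
case=> uM sM cM vS aS newT.
have vM : v \notin flatM M by apply: contra vS => /sM.
suff [s [us ss [va vav] cs]] : exists s, [/\ uniq s, {subset s <= v |: S},
    (exists u w, [/\ u \in [set v; a], w \in [set v; a] & consec s u w]) &
    forall q, q \in M -> consec s q.1 q.2].
  exists s; split=> // T tT TS; have [vT|vT] := boolP (v \in T).
    have [w [uva wva cuw]] := vav; exists va, w; rewrite (newT T) //; split=> //.
      by move: uva; rewrite !inE => /orP[]->; rewrite ?orbT.
    by move: wva; rewrite !inE => /orP[]->; rewrite ?orbT.
  have TS' : T \subset S.
    apply/fintype.subsetP=> x xT; move/fintype.subsetP/(_ x xT): TS; rewrite !inE.
    by case/orP=> // /eqP xv; rewrite -xv xT in vT.
  have [q qM /andP[q1 q2]] := cM T tT TS'.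
  by exists q.1, q.2; split=> //; apply: cs.
(* If [a] is in no pair, [a] and [v] are appended at the end; otherwise [v] goes on the outer side
   of [a], so that the pair containing [a] stays consecutive. *)
have [/flatMP[q qM aq]|aM] := boolP (a \in flatM M); last first.
  exists (flatM M ++ [:: a; v]); split.
  - rewrite cat_uniq uM /= (negbTE aM) (negbTE vM) /= !inE !andbT.
    by apply/eqP => av; rewrite -av aS in vS.
  - move=> x; rewrite mem_cat !inE => /orP[/sM ->|/orP[]/eqP->]; rewrite ?orbT ?eqxx ?aS ?orbT //.
  - by exists a, v; rewrite !inE !eqxx orbT; split=> //; apply: consec_catr; exists [::], [::].
  - by move=> q /consec_flatM; apply: consec_catl.
move: uM sM vM; have [M1 [M2 eM]] : exists M1 M2, M = M1 ++ q :: M2.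
  by case/path.splitPr: qM => M1 M2; exists M1, M2.
rewrite eM flatM_cat flatM_cons => uM sM vM.
have sub s : perm_eq s (v :: (flatM M1 ++ [:: q.1, q.2 & flatM M2])) -> uniq s /\ {subset s <= v |: S}.
  move=> ps; split; first by rewrite (perm_uniq ps) /= vM.
  by move=> x; rewrite (perm_mem ps) inE => /orP[/eqP->|/sM]; rewrite !inE ?eqxx // => ->; rewrite orbT.
case/orP: aq => /eqP aq.
- exists (flatM M1 ++ [:: v, q.1, q.2 & flatM M2]).
  have [|us ss] := sub (flatM M1 ++ [:: v, q.1, q.2 & flatM M2]).
    by rewrite perm_catC cat_cons perm_cons perm_catC.
  split=> //; first by exists v, a; rewrite !inE !eqxx orbT aq; split=> //; exists (flatM M1), (q.2 :: flatM M2).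
  move=> r; rewrite mem_cat inE => /or3P[/consec_flatM|/eqP->|/consec_flatM].
  + by apply: consec_catl.
  + by exists (flatM M1 ++ [:: v]), (flatM M2); rewrite -catA.
  + by move=> cr; apply: consec_catr; apply: (@consec_catr _ _ [:: v; q.1; q.2]).
- exists (flatM M1 ++ [:: q.1, q.2, v & flatM M2]).
  have [|us ss] := sub (flatM M1 ++ [:: q.1, q.2, v & flatM M2]).
    have -> : flatM M1 ++ [:: q.1, q.2, v & flatM M2] = (flatM M1 ++ [:: q.1; q.2]) ++ v :: flatM M2 by rewrite -catA.
    by rewrite perm_catC cat_cons perm_cons perm_catC -catA.
  split=> //; first by exists a, v; rewrite !inE !eqxx orbT aq; split=> //; exists (flatM M1 ++ [:: q.1]), (flatM M2); rewrite -catA.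
  move=> r; rewrite mem_cat inE => /or3P[/consec_flatM|/eqP->|/consec_flatM].
  + by apply: consec_catl.
  + by exists (flatM M1), (v :: flatM M2).
  + by move=> cr; apply: consec_catr; apply: (@consec_catr _ _ [:: q.1; q.2; v]).
Qed.

Lemma disjoint_setU (A B C : {set V}) :
  [disjoint A :|: B & C] = [disjoint A & C] && [disjoint B & C].
Proof. by rewrite -!setI_eq0 finset.setIUl setU_eq0. Qed.

Lemma triangle_rest T x : triangle T -> x \in T ->
  exists a b, [/\ a != b, T = x |: [set a; b], a != x, b != x & [/\ adj x a, adj x b & adj a b]].
Proof.
case=> cT kT xT; have : #|T :\ x| = 2 by move: (cardsD1 x T); rewrite xT cT => -[].
move=> /eqP/cards2P[a [b [ab eT]]]; exists a, b.
have aT : a \in T :\ x by rewrite eT !inE eqxx.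
have bT : b \in T :\ x by rewrite eT !inE eqxx orbT.
move: aT bT; rewrite !inE => /andP[ax aT] /andP[bx bT].
by split=> //; [rewrite -eT finset.setD1K | split; apply: kT => //; rewrite eq_sym].
Qed.

Lemma nbrs_ge2 v S a b : a \in S -> b \in S -> a != b -> adj v a -> adj v b -> 2 <= #|nbrs v S|.
Proof.
move=> aS bS ab va vb; rewrite (_ : 2 = #|[set a; b]|); last by rewrite cards2 ab.
by apply/subset_leq_card/fintype.subsetP=> x; rewrite !inE => /orP[]/eqP->; rewrite ?aS ?bS.
Qed.

Lemma subsetU1_notin T v S : T \subset v |: S -> v \notin T -> T \subset S.
Proof.
move=> /fintype.subsetP TS vT; apply/fintype.subsetP=> x xT.
by move: (TS x xT); rewrite !inE => /orP[/eqP xv|//]; rewrite -xv xT in vT.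
Qed.

(** * Growing one cluster of triangles *)

Variable K : nat.
Hypothesis K4 : 3 < K.
Hypothesis sparse : forall S, S != set0 -> #|S| <= K -> arcs S < 3 * #|S|.
Hypothesis small : forall S, #|S| <= K -> K <= #|S|.+1 -> arcs S + 3 < 3 * #|S|.

(** [W] stands for the union of the clusters that have already been listed. *)
Definition triangle_closed W := forall T, triangle T -> T \subset W \/ [disjoint T & W].

Definition no_diamond W := forall T T' a b, triangle T -> triangle T' -> a != b ->
  a \in T :&: T' -> b \in T :&: T' -> [disjoint T & W] -> [disjoint T' & W] -> T = T'.

(* The excess [3 #|S| - arcs S] starts at 3 and drops by one whenever a vertex
   is attached to an edge; sparseness keeps it positive. *)
Definition growing W S := [/\ [disjoint S & W], S != set0, #|S| <= K &
  [\/ [/\ 3 * #|S| <= arcs S + 3, exists M, pair_cover S M, no_diamond W &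
        forall a b, a \in S -> b \in S -> adj a b -> exists T, [/\ triangle T, T \subset S, a \in T & b \in T]],
      3 * #|S| <= arcs S + 2 /\ exists M, pair_cover S M |
      3 * #|S| <= arcs S + 1 /\ exists s, seq_cover S s]].

(** A growing set has excess at most 3, which [small] excludes for the sizes [K - 1] and [K]; this
    bounds the clusters and leaves room for two more vertices. *)
Lemma growing_room W S : growing W S -> #|S|.+2 <= K.
Proof.
case=> _ _ SK H; rewrite ltnNge; apply/negP => KS.
have := small SK KS; case: H => [[]|[]|[]]; lia.
Qed.

(** The vertex [v] brings at least two edges, that is four arcs against an allowance of three. In
    the first state the edge of [T] opposite to [v] lies in a second triangle, inside [S], which
    [no_diamond] forbids; in the third state the excess would vanish. In the second state [v] has
    exactly two neighbours in [S], so [T] is the only new triangle and splicing covers it. *)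
Lemma attach_vertex W S T v : triangle_closed W -> growing W S -> triangle T ->
  v \in T -> v \notin S -> T \subset v |: S -> growing W (v |: S).
Proof.
move=> cW gS tT vT vS TS; have room := growing_room gS.
have [a [b [ab eT av bv [va vb adab]]]] := triangle_rest tT vT.
have aS : a \in S by move/fintype.subsetP/(_ a): TS; rewrite eT !inE eqxx orbT (negbTE av) /=; apply.
have bS : b \in S by move/fintype.subsetP/(_ b): TS; rewrite eT !inE eqxx !orbT (negbTE bv) /=; apply.
have nb2 := nbrs_ge2 aS bS ab va vb.
have cS' : #|v |: S| = #|S|.+1 by rewrite cardsU1 vS.
have aS' := arcsU1 vS.
have S'0 : v |: S != set0 by apply/set0Pn; exists v; rewrite !inE eqxx.
have := sparse S'0; rewrite cS' => /(_ (ltnW room)) sp.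
case: gS => dS S0 SK st.
have dT : [disjoint T & W].
  case: (cW T tT) => // /fintype.subsetP/(_ a); rewrite eT !inE eqxx orbT => /(_ isT) aW.
  by move: (disjointFr dS aS); rewrite aW.
have dS' : [disjoint v |: S & W].
  by rewrite disjoint_setU dS andbT disjoints1 (disjointFr dT vT).
split=> //; first by rewrite cS' ltnW.
case: st => [[ex _ nd eT']|[ex [M cM]]|[ex _]]; last by clear -ex sp aS' cS' nb2; lia.
  have [T' [tT' T'S aT' bT']] := eT' a b aS bS adab.
  have TT' : T = T'.
    apply: (nd T T' a b) => //; rewrite ?inE ?aT' ?bT' ?andbT.
    - by rewrite eT !inE eqxx orbT.
    - by rewrite eT !inE eqxx !orbT.
    - by apply: disjointWl dS.
  by move: vT; rewrite TT' => /(fintype.subsetP T'S); rewrite (negbTE vS).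
constructor 3; split; first by clear -ex sp aS' cS' nb2; lia.
have nb : nbrs v S = [set a; b].
  apply/eqP; rewrite eq_sym eqEcard cards2 ab; apply/andP; split; last by clear -ex sp aS' cS' nb2; lia.
  by apply/fintype.subsetP=> x; rewrite !inE => /orP[]/eqP->; rewrite ?aS ?bS.
apply: (pair_cover_splice (b := b) cM vS aS) => T' tT' T'S vT'.
have [a' [b' [ab' eT' av' bv' [va' vb' _]]]] := triangle_rest tT' vT'.
have sT' : [set a'; b'] \subset [set a; b].
  rewrite -nb; apply/fintype.subsetP=> x xab.
  have : x \in v |: S by apply: (fintype.subsetP T'S); rewrite eT' inE xab orbT.
  by move: xab; rewrite !inE => /orP[]/eqP->; rewrite ?(negbTE av') ?(negbTE bv') /= => ->.
rewrite eT'; congr (_ |: _); apply/eqP; rewrite eqEcard sT' !cards2 ab ab' //.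
Qed.

(** Two vertices with three edges keep the excess, and every further edge lowers it by two. No
    triangle has exactly one vertex outside [S], so each new triangle contains both new vertices,
    and one new pair covers them all. *)
Lemma attach_pair W S T z : triangle_closed W -> growing W S -> triangle T ->
  z \in T -> z \in S -> #|T :\: S| = 2 ->
  (forall v T', v \notin S -> triangle T' -> v \in T' -> ~~ (T' \subset v |: S)) ->
  growing W (S :|: T).
Proof.
move=> cW gS tT zT zS dTS nov; have room := growing_room gS.
have [x [y [xy eT xz yz [zx zy adxy]]]] := triangle_rest tT zT.
have eD : T :\: S = [set x; y].
  apply/eqP; rewrite eqEcard dTS cards2 xy andbT; apply/fintype.subsetP=> u.
  by rewrite eT !inE => /andP[uS /or3P[/eqP uz|->|->]]; rewrite ?orbT //; rewrite uz zS in uS.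
have [/setDP[_ xS] /setDP[_ yS]] : x \in T :\: S /\ y \in T :\: S by rewrite eD !inE !eqxx orbT.
have eS' : S :|: T = x |: (y |: S).
  by apply/setP=> u; rewrite eT !inE; case: (eqVneq u z) => [->|_]; rewrite ?zS ?orbT //= orbC orbA.
have xyS : x \notin y |: S by rewrite !inE negb_or xy.
have cS' : #|S :|: T| = #|S|.+2 by rewrite eS' !cardsU1 xyS yS.
have aS' : arcs (S :|: T) = arcs S + #|nbrs y S|.*2 + #|nbrs x (y |: S)|.*2.
  by rewrite eS' arcsU1 // arcsU1.
have nx2 : 2 <= #|nbrs x (y |: S)|.
  by apply: (@nbrs_ge2 _ _ y z); rewrite ?inE ?eqxx ?zS ?orbT // adj_sym.
have ny1 : 0 < #|nbrs y S| by apply/card_gt0P; exists z; rewrite inE zS adj_sym.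
have S'0 : S :|: T != set0 by apply/set0Pn; exists z; rewrite !inE zS.
have := sparse S'0; rewrite cS' => /(_ room) sp.
case: gS => dS S0 SK st.
have dT : [disjoint T & W].
  case: (cW T tT) => // /fintype.subsetP/(_ z zT) zW.
  by move: (disjointFr dS zS); rewrite zW.
have dS' : [disjoint S :|: T & W] by rewrite disjoint_setU dT dS.
have newT T' : triangle T' -> T' \subset S :|: T -> ~~ (T' \subset S) -> x \in T' /\ y \in T'.
  move=> tT'; rewrite eS' => T'S T'nS; have [xT'|xT'] := boolP (x \in T'); have [yT'|yT'] := boolP (y \in T') => //.
  - have T'xS : T' \subset x |: S.
      by apply: (@subsetU1_notin _ y) yT'; rewrite finset.setUCA.
    by move: (nov x T' xS tT' xT'); rewrite T'xS.
  - by move: (nov y T' yS tT' yT'); rewrite (subsetU1_notin T'S xT').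
  - by move: T'nS; rewrite (subsetU1_notin (subsetU1_notin T'S xT') yT').
have pc M : pair_cover S M -> pair_cover (S :|: T) ((x, y) :: M).
  case=> uM sM cM; split.
  - rewrite flatM_cons /= inE negb_or xy uM andbT /=.
    by apply/andP; split; [move: xS | move: yS]; apply: contra => /sM.
  - rewrite eS' => u; rewrite flatM_cons !inE => /or3P[->|->|/sM->]; rewrite ?orbT //.
  - move=> T' tT' T'S; have [T'S'|T'S'] := boolP (T' \subset S).
      by have [q qM qT] := cM T' tT' T'S'; exists q => //; rewrite inE qM orbT.
    by have [xT' yT'] := newT T' tT' T'S T'S'; exists (x, y); rewrite ?inE ?eqxx //= xT'.
have sc s : seq_cover S s -> exists s', seq_cover (S :|: T) s'.
  case=> us ss cs; exists (x :: y :: s); split.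
  - rewrite /= inE negb_or xy us andbT /=.
    by apply/andP; split; [move: xS | move: yS]; apply: contra => /ss.
  - by rewrite eS' => u; rewrite !inE => /or3P[->|->|/ss->]; rewrite ?orbT.
  - move=> T' tT' T'S; have [T'S'|T'S'] := boolP (T' \subset S).
      have [u [w [uT' wT' cuw]]] := cs T' tT' T'S'; exists u, w; split=> //.
      by apply: (@consec_catr _ _ [:: x; y]).
    have [xT' yT'] := newT T' tT' T'S T'S'; exists x, y; split=> //.
    by exists [::], s.
split=> //; first by rewrite cS'.
case: st => [[ex [M cM] nd eTr]|[ex [M cM]]|[ex [s cs]]]; last 2 first.
- by constructor 2; split; [clear -ex cS' aS' nx2 ny1 sp; lia | exists ((x, y) :: M); apply: pc].
- by constructor 3; split; [clear -ex cS' aS' nx2 ny1 sp; lia | apply: sc cs].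
(* With a fourth new edge the excess falls from 3 to at most 1, and the third state is reached. With
   three new edges all of them lie in [T], and the first state persists. *)
have [eq|ne] := boolP ((#|nbrs x (y |: S)| == 2) && (#|nbrs y S| == 1)); last first.
  constructor 3; split; first by move: ne; rewrite negb_and => /orP[]/eqP; clear -ex cS' aS' nx2 ny1 sp; lia.
  by exists (flatM ((x, y) :: M)); apply/pair_seq_cover/pc.
case/andP: eq => /eqP nx /eqP ny.
constructor 1; split; [by clear -ex cS' aS' nx2 ny1 sp; lia | by exists ((x, y) :: M); apply: pc | by [] |].
have Ny : nbrs y S = [set z].
  by apply/eqP; rewrite eq_sym eqEcard cards1 ny andbT sub1set inE zS adj_sym.
have Nx : nbrs x (y |: S) = [set y; z].
  apply/eqP; rewrite eq_sym eqEcard cards2 yz nx andbT.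
  by apply/fintype.subsetP=> u; rewrite !inE => /orP[]/eqP->; rewrite ?eqxx ?zS ?orbT //= adj_sym.
have xyT : [set x; y] \subset T by rewrite eT finset.subsetUr.
have xT : x \in T by apply: (fintype.subsetP xyT); rewrite !inE eqxx.
have yT : y \in T by apply: (fintype.subsetP xyT); rewrite !inE eqxx orbT.
have TS' : T \subset S :|: T by rewrite finset.subsetUr.
have key a b : adj a b -> (a == x) || (a == y) -> b \in S :|: T -> exists T0, [/\ triangle T0, T0 \subset S :|: T, a \in T0 & b \in T0].
  move=> adab axy bS; exists T; move: adab; case/orP: axy => /eqP-> adab; split=> //.
  - have : b \in nbrs x (y |: S).
      rewrite inE adab andbT; move: bS; rewrite eS' !inE => /or3P[/eqP bx|->|->]; rewrite ?orbT //.
      by move: adab; rewrite bx adj_irr.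
    by rewrite Nx !inE => /orP[]/eqP->.
  - move: bS; rewrite eS' !inE => /or3P[/eqP->//|/eqP->//|bS].
    have : b \in nbrs y S by rewrite inE bS.
    by rewrite Ny !inE => /eqP->.
move=> a b; rewrite {1 2}eS' !inE.
have [axy _|axy] := boolP ((a == x) || (a == y)).
  by move=> bS adab; apply: key => //; rewrite eS' !inE.
have [bxy|bxy] := boolP ((b == x) || (b == y)).
  move=> aS _; rewrite adj_sym => adab.
  have [|T0 [? ? ? ?]] := key b a adab bxy; first by rewrite eS' !inE.
  by exists T0.
rewrite !orbA (negbTE axy) (negbTE bxy) /= => aS bS adab.
have [T0 [? T0S ? ?]] := eTr a b aS bS adab; exists T0; split=> //.
by apply: fintype.subset_trans T0S _; rewrite finset.subsetUl.
Qed.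

(** Triangles with a single vertex outside [S] are attached first, even if [T] is not one of them.
    When none is left, [T] has exactly two vertices outside [S] and [attach_pair] applies. *)
Lemma growing_step W S T : triangle_closed W -> growing W S -> triangle T ->
  ~~ (T \subset S) -> ~~ [disjoint T & S] -> exists2 S' : {set V}, S \proper S' & growing W S'.
Proof.
move=> cW gS tT TS /pred0Pn[z /andP[/= zT zS]].
have [[v [T' [vS tT' vT' T'S]]]|nov] := boolp.pselect (exists v T', [/\ v \notin S, triangle T', v \in T' & T' \subset v |: S]).
  exists (v |: S); last exact: attach_vertex tT' vT' vS T'S.
  by rewrite properE finset.subsetUr; apply/fintype.subsetPn; exists v; rewrite ?inE ?eqxx.
have nov' v T' : v \notin S -> triangle T' -> v \in T' -> ~~ (T' \subset v |: S).
  by move=> vS tT' vT'; apply/negP => T'S; apply: nov; exists v, T'.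
exists (S :|: T).
  rewrite properE finset.subsetUl /=; apply: contra TS; apply: fintype.subset_trans; exact: finset.subsetUr.
apply: (attach_pair cW gS tT zT zS) => //; move/fintype.subsetPn: TS => [x xT xS].
have zI : z \in T :&: S by rewrite inE zT.
have := cardsID S T; rewrite tT.1 => cT.
have c1 : 0 < #|T :&: S| by apply/card_gt0P; exists z.
have c2 : #|T :\: S| != 1.
  apply/negP => /cards1P[v ev].
  have /setDP[vT vS] : v \in T :\: S by rewrite ev inE.
  move: (nov' v T vS tT vT); rewrite -(finset.setID T S) ev finset.setUC finset.setUS //; exact: finset.subsetIr.
have c3 : 0 < #|T :\: S| by apply/card_gt0P; exists x; rewrite !inE xS.
by move: c2 => /eqP; lia.
Qed.

Lemma arcs_set2 a b : a != b -> adj a b -> 2 <= arcs [set a; b].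
Proof.
move=> ab adab; rewrite arcsU1 ?inE // (_ : nbrs a [set b] = [set b]) ?cards1; first by lia.
by apply/setP=> x; rewrite !inE andb_idr // => /eqP->.
Qed.

Lemma growing_triangle W T : no_diamond W -> triangle T -> [disjoint T & W] -> growing W T.
Proof.
move=> nd tT dT; have [cT kT] := tT.
have [x xT] : exists x, x \in T by apply/card_gt0P; rewrite cT.
have [a [b [ab eT ax bx [xa xb adab]]]] := triangle_rest tT xT.
have xab : x \notin [set a; b] by rewrite !inE negb_or ![x == _]eq_sym ax.
have := arcs_set2 ab adab.
have : 2 <= #|nbrs x [set a; b]| by apply: (nbrs_ge2 _ _ ab xa xb); rewrite !inE eqxx ?orbT.
have eqT T' : triangle T' -> T' \subset T -> T' = T.
  by move=> [cT' _] T'T; apply/eqP; rewrite eqEcard T'T cT cT'.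
split=> //; [by apply/set0Pn; exists x | by rewrite cT ltnW |].
constructor 1; split=> //; first by rewrite cT eT arcsU1 //; lia.
- exists [:: (a, b)]; split; first by rewrite /= inE ab.
    by move=> y; rewrite eT !inE => /orP[]->; rewrite ?orbT.
  by move=> T' tT' /(eqT T' tT')->; exists (a, b); rewrite ?inE ?eqxx //= eT !inE !eqxx !orbT.
- by move=> u w uT wT _; exists T; split.
Qed.

(** Four vertices and five edges have excess 2; a sixth edge would make it 0. So the two tips are
    not adjacent, every triangle inside contains the common edge, and that edge serves as the only
    pair. *)
Lemma growing_diamond W T T' a b : triangle T -> triangle T' -> a != b ->
  a \in T :&: T' -> b \in T :&: T' -> [disjoint T & W] -> [disjoint T' & W] -> T != T' ->
  growing W (T :|: T').
Proof.
move=> tT tT' ab /setIP[aT aT'] /setIP[bT bT'] dT dT' TT'.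
have third T1 : triangle T1 -> a \in T1 -> b \in T1 -> exists c, [/\ T1 = c |: [set a; b], c \notin [set a; b], adj c a & adj c b].
  move=> [cT1 kT1] aT1 bT1; have : #|T1 :\: [set a; b]| = 1.
    rewrite cardsD cT1 (setIidPr _) ?cards2 ?ab //.
    by apply/fintype.subsetP=> x; rewrite !inE => /orP[]/eqP->.
  move=> /eqP/cards1P[c ec]; exists c.
  have /setDP[cT1' cab] : c \in T1 :\: [set a; b] by rewrite ec inE.
  have [ca cb] : c != a /\ c != b by apply/andP; move: cab; rewrite !inE negb_or.
  split; rewrite ?kT1 //; rewrite -ec; apply/setP=> x; rewrite !inE.
  by case: (eqVneq x a) => [->|] //=; case: (eqVneq x b) => [->|] //=; rewrite ?andbT ?orbF.
have [c [eT cab ca cb]] := third T tT aT bT.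
have [d [eT' dab da db]] := third T' tT' aT' bT'.
have dc : d != c by apply: contra TT' => /eqP dc; rewrite eT eT' dc.
have eS : T :|: T' = d |: (c |: [set a; b]).
  by rewrite eT eT'; apply/setP=> x; rewrite !inE; do 4?case: (x == _).
have dcab : d \notin c |: [set a; b] by rewrite in_setU1 negb_or dc.
have cS : #|T :|: T'| = 4 by rewrite eS cardsU1 dcab cardsU1 cab cards2 ab.
have adab : adj a b by apply: tT.2.
have ab2 := arcs_set2 ab adab.
have c2 : 2 <= #|nbrs c [set a; b]| by apply: (nbrs_ge2 _ _ ab ca cb); rewrite !inE eqxx ?orbT.
have d2 : 2 <= #|nbrs d (c |: [set a; b])| by apply: (nbrs_ge2 _ _ ab da db); rewrite !inE eqxx ?orbT.
have aS : arcs (T :|: T') = arcs [set a; b] + #|nbrs c [set a; b]|.*2 + #|nbrs d (c |: [set a; b])|.*2.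
  by rewrite eS arcsU1 // arcsU1.
have S0 : T :|: T' != set0 by rewrite -card_gt0 cS.
have := sparse S0; rewrite cS => /(_ K4) sp.
have dcN : ~~ adj d c.
  apply/negP => addc; suff : 3 <= #|nbrs d (c |: [set a; b])| by clear -sp aS ab2 c2; lia.
  rewrite (_ : 3 = #|c |: [set a; b]|); last by rewrite cardsU1 cab cards2 ab.
  apply/subset_leq_card/fintype.subsetP=> x; rewrite !inE => xcab; rewrite xcab /=.
  by case/or3P: xcab => /eqP->.
split=> //; [by rewrite disjoint_setU dT | by rewrite cS |].
constructor 2; split; first by rewrite cS; clear -aS ab2 c2 d2; lia.
exists [:: (a, b)]; split; first by rewrite /= inE ab.
  by rewrite eS => y; rewrite !inE => /orP[]->; rewrite ?orbT.
move=> T1 tT1; have [cT1 kT1] := tT1 => T1S; exists (a, b); rewrite ?inE ?eqxx //=.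
have no x y : [set x; y] = [set a; b] -> x \in T1.
  move=> exy; apply/negPn/negP => xT1; move/negP: dcN; apply.
  have T1y : T1 \subset y |: [set d; c].
    apply: (@subsetU1_notin _ x) xT1; apply: (fintype.subset_trans T1S); rewrite eS -exy.
    by apply/fintype.subsetP=> z; rewrite !inE; do 4?case: (z == _).
  have eT1 : T1 = y |: [set d; c].
    by apply/eqP; rewrite eqEcard T1y cT1 cardsU1 cards2 dc; case: (y \notin _).
  by apply: kT1 => //; rewrite eT1 !inE eqxx ?orbT.
by rewrite (no a b) ?(no b a) // finset.setUC.
Qed.

Lemma growing_closed W S : triangle_closed W -> growing W S ->
  exists2 S', growing W S' & forall T, triangle T -> T \subset S' \/ [disjoint T & S'].
Proof.
move=> cW; have [m] := ubnP #|~: S|; elim: m S => // m IH S Sm gS.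
have [[T [tT TS dTS]]|H] := boolp.pselect (exists T, [/\ triangle T, ~~ (T \subset S) & ~~ [disjoint T & S]]).
  have [S' SS' gS'] := growing_step cW gS tT TS dTS.
  apply: (IH S') => //; rewrite -ltnS; apply: leq_trans Sm; rewrite !ltnS; apply: proper_card.
  by rewrite properC.
exists S => // T tT; have [|TS] := boolP (T \subset S); first by left.
by right; apply/negPn/negP => dTS; apply: H; exists T.
Qed.

(** A diamond outside [W] is preferred as seed. Only when there is none does a single triangle
    serve, and then [no_diamond W] is available, as the first state of [growing] requires. *)
Lemma triangle_closed_extend W s T : triangle_closed W -> seq_cover W s -> triangle T ->
  ~~ (T \subset W) -> exists W' s', [/\ W \proper W', triangle_closed W' & seq_cover W' s'].
Proof.
move=> cW [us ss cs] tT TW; have dT : [disjoint T & W] by case: (cW T tT) => // TW'; rewrite TW' in TW.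
have [S gS] : exists S, growing W S.
  have [nd|] := boolp.pselect (no_diamond W); first by exists T; apply: growing_triangle.
  rewrite /no_diamond => nd; apply: boolp.contrapT => nS; apply: nd => T1 T2 a b t1 t2 ab a1 b1 d1 d2.
  apply/eqP/negPn/negP => T12; apply: nS; exists (T1 :|: T2).
  exact: (@growing_diamond W T1 T2 a b).
have {S gS} [S [dS S0 _ st] cS] := growing_closed cW gS.
have [s' [us' ss' cs']] : exists s', seq_cover S s'.
  case: st => [[_ [M cM] _ _]|[_ [M cM]]|[_ [s' cs']]]; last by exists s'.
    by exists (flatM M); apply: pair_seq_cover.
  by exists (flatM M); apply: pair_seq_cover.
exists (W :|: S), (s ++ s'); split.
- rewrite properE finset.subsetUl; have /set0Pn[x xS] := S0.
  by apply/fintype.subsetPn; exists x; rewrite ?inE ?xS ?orbT // (disjointFr dS xS).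
- move=> T1 t1; case: (cW T1 t1) => [T1W|d1].
    by left; apply: fintype.subset_trans T1W _; apply: finset.subsetUl.
  case: (cS T1 t1) => [T1S|d2]; first by left; apply: fintype.subset_trans T1S _; apply: finset.subsetUr.
  by right; rewrite disjoint_sym disjoint_setU !(disjoint_sym _ T1) d1.
- split.
  + rewrite cat_uniq us us' andbT /=; apply/hasPn => x /ss' xS; apply/negP => /ss xW.
    by move: (disjointFr dS xS); rewrite xW.
  + by move=> x; rewrite mem_cat inE => /orP[/ss->|/ss'->]; rewrite ?orbT.
  + move=> T1 t1 T1WS; case: (cW T1 t1) => [T1W|d1].
      have [u [w [? ? ?]]] := cs T1 t1 T1W; exists u, w; split=> //; exact: consec_catl.
    have [|u [w [? ? ?]]] := cs' T1 t1.
      apply/fintype.subsetP => x xT1; move/fintype.subsetP/(_ x xT1): T1WS.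
      by rewrite inE (disjointFr d1 xT1).
    by exists u, w; split=> //; apply: consec_catr.
Qed.

Lemma sparse_triangle_cover : exists s, seq_cover [set: V] s.
Proof.
suff : forall m W s, #|~: W| < m -> triangle_closed W -> seq_cover W s -> exists s, seq_cover [set: V] s.
  move/(_ _ set0 [::] (ltnSn _)); apply.
    by move=> T _; right; rewrite -setI_eq0 finset.setI0.
  by split=> // T [cT _]; rewrite finset.subset0 => /eqP T0; rewrite T0 cards0 in cT.
elim=> // m IH W s Wm cW cs.
have [[T [tT TW]]|H] := boolp.pselect (exists T, triangle T /\ ~~ (T \subset W)).
  have [W' [s' [WW' cW' cs']]] := triangle_closed_extend cW cs tT TW.
  apply: (IH W' s') => //; rewrite -ltnS; apply: leq_trans Wm; rewrite !ltnS; apply: proper_card.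
  by rewrite properC.
case: cs => us ss cs; exists s; split=> [//|x _|T tT _]; [by rewrite inE | apply: cs => //].
by apply/negPn/negP => TW; apply: H; exists T.
Qed.

End TriangleCover.

From mathcomp Require Import all_classical all_reals all_analysis ring lra.
Import numFieldNormedType.Exports.
Import Order.TTheory GRing.Theory Num.Theory.
Local Open Scope ring_scope.

(** * Sparse random graphs and complete bipartite graphs *)

Lemma arcs_clique (V : finType) (adj : rel V) (Q : {set V}) :
  irreflexive adj -> clique adj Q -> arcs adj Q = (#|Q| * #|Q|.-1)%N.
Proof.
move=> irr kQ; rewrite /arcs -sum_nat_const; apply: eq_bigr => x xQ.
rewrite (cardsD1 x) xQ /= -sum1_card (big_setD1 x) //= irr add0n.
by apply: eq_bigr => y; rewrite !inE => /andP[yx yQ]; rewrite kQ // eq_sym.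
Qed.

Lemma consec_index (V : eqType) (s : seq V) u w :
  uniq s -> consec s u w -> index w s = (index u s).+1.
Proof.
move=> + [s1 [s2 es]]; rewrite es cat_uniq /= => /and3P[_ /norP[us1 /norP[ws1 _]] /andP[uw _]].
rewrite !index_cat (negbTE us1) (negbTE ws1) /= eqxx.
by move: uw; rewrite inE negb_or eq_sym => /andP[/negbTE -> _]; rewrite eqxx addn0 addn1.
Qed.

Definition cut n (A : {set 'I_n}) := [set e in pairs n | #|e :&: A| == 1]%N.

Definition adjacent n (H : {set {set 'I_n}}) : rel 'I_n := fun x y => (x != y) && ([set x; y] \in H).

Lemma adjacent_sym n (H : {set {set 'I_n}}) : symmetric (adjacent H).
Proof. by move=> x y; rewrite /adjacent eq_sym finset.setUC. Qed.

Lemma adjacent_irr n (H : {set {set 'I_n}}) : irreflexive (adjacent H).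
Proof. by move=> x; rewrite /adjacent eqxx. Qed.

Lemma sparse_cut_not_rbw n (A : {set 'I_n}) (H : {set {set 'I_n}}) K :
  (5 < K)%N -> H \subset pairs n ->
  (forall S : {set 'I_n}, S != finset.set0 -> #|S| <= K -> arcs (adjacent H) S < 3 * #|S|)%N ->
  (forall S : {set 'I_n}, #|S| <= K -> K <= #|S|.+1 -> arcs (adjacent H) S + 3 < 3 * #|S|)%N ->
  ~ rbw_K6 (cut A :|: H).
Proof.
move=> K5 HP sp sm rbw.
have [s [us _ cs]] := sparse_triangle_cover (@adjacent_sym n H) (@adjacent_irr n H) (ltnW (ltnW K5)) sp sm.
(* Appending the unlisted vertices makes [f] injective on all vertices. *)
pose f x := index x (s ++ [seq x <- enum 'I_n | x \notin s]).
have inf x : x \in s ++ [seq x <- enum 'I_n | x \notin s].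
  by rewrite mem_cat mem_filter mem_enum andbT orbN.
have finj : injective f by move=> x y fxy; exact: (index_inj x (inf x) (inf y) fxy).
have fsucc T : triangle (adjacent H) T -> exists u w, [/\ u \in T, w \in T & f w = (f u).+1].
  move=> tT; have [u [w [uT wT cuw]]] := cs T tT (finset.subsetT T).
  exists u, w; split=> //; apply: consec_index; last exact: consec_catl.
  rewrite cat_uniq us filter_uniq ?enum_uniq // andbT; apply/hasPn => x.
  by rewrite mem_filter => /andP[].
pose cross (e : {set 'I_n}) := (#|e :&: A| == 1)%N.
(* Even colours are used across the cut and private odd colours elsewhere, so the two kinds never
   agree. *)
pose c (e : {set 'I_n}) : nat :=
  if cross e then (\sum_(x in e) f x).*2%N else (nat_of_ord (enum_rank e)).*2.+1.
have c2 x y : x != y -> (\sum_(z in [set x; y]%SET) f z = f x + f y)%N.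
  by move=> xy; rewrite finset.big_setU1 ?inE //= big_set1.
have prop : proper_colouring (cut A :|: H) c.
  have GP : cut A :|: H \subset pairs n.
    by rewrite finset.subUset HP andbT; apply/fintype.subsetP => e; rewrite inE => /andP[].
  move=> e g eG gG eg /pred0Pn[x /andP[/= xe xg]]; apply/eqP; rewrite /c.
  have := fintype.subsetP GP _ eG; have := fintype.subsetP GP _ gG; rewrite !inE => /eqP c2g /eqP c2e.
  have other (h : {set 'I_n}) : #|h| = 2%N -> x \in h -> exists2 y, x != y & h = [set x; y]%SET.
    move=> ch xh; have /eqP/cards1P[y ey] : #|h :\ x| = 1%N by move: (cardsD1 x h); rewrite ch xh => -[].
    exists y; last by rewrite -(finset.setD1K xh) ey.
    have : y \in h :\ x by rewrite ey inE.
    by rewrite !inE eq_sym => /andP[].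
  have [y xy ee] := other e c2e xe; have [z xz ez] := other g c2g xg.
  case: (cross e); case: (cross g) => //.
  - rewrite ee ez !c2 // => /double_inj/addnI/finj yz.
    by move/eqP: eg; rewrite ee ez yz.
  - by move=> /(congr1 odd); rewrite /= !odd_double.
  - by move=> /(congr1 odd); rewrite /= !odd_double.
  - by move=> [] /double_inj /ord_inj /enum_rank_inj; move/eqP: eg.
have [S [cS [SG inj]]] := rbw c prop.
have side (B : {set 'I_n}) : B = A \/ B = ~: A -> clique (adjacent H) (S :&: B).
  move=> BA x y /setIP[xS xB] /setIP[yS yB] xy; rewrite /adjacent xy.
  have xyS : [set x; y]%SET \subset S.
    by apply/fintype.subsetP=> z; rewrite !inE => /orP[]/eqP->.
  have := SG _ xyS; rewrite cards2 xy => /(_ erefl); rewrite !inE => /orP[|->//].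
  case/andP => _ /eqP; case: BA => eB.
    rewrite (finset.setIidPl _) ?cards2 ?xy //; apply/fintype.subsetP=> z.
    by rewrite !inE -eB => /orP[]/eqP->.
  rewrite (_ : _ :&: A = finset.set0) ?cards0 //; apply/setP=> z; rewrite !inE.
  by apply/negbTE; rewrite negb_and orbC -implybE; apply/implyP=> zA; apply/negP => /orP[]/eqP zx;
    [move: xB | move: yB]; rewrite eB -zx inE zA.
(* A clique on q vertices has q(q-1) arcs, fewer than 3q by sparseness, hence q is at most 3. *)
have small (B : {set 'I_n}) : B = A \/ B = ~: A -> (#|S :&: B| <= 3)%N.
  move=> /side kB; have [->|nz] := eqVneq (S :&: B) finset.set0; first by rewrite cards0.
  have : (#|S :&: B| <= #|S|)%N by apply/subset_leq_card/finset.subsetIl.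
  rewrite cS => le6; have := sp _ nz (leq_trans le6 K5).
  rewrite (arcs_clique (@adjacent_irr n H) kB); move: nz; rewrite -card_gt0.
  by case: #|_| => // q _; rewrite /= mulnC ltn_mul2r => /andP[_].
have cA := small A (or_introl erefl); have cB := small (~: A) (or_intror erefl).
have sumS : (#|S :&: A| + #|S :&: ~: A| = 6)%N.
  by rewrite -cS -(cardsID A S) finset.setDE.
have [eA eB] : #|S :&: A| = 3%N /\ #|S :&: ~: A| = 3%N.
  by clear -cA cB sumS; move: cA cB sumS; move: #|_| #|_| => x y; lia.
have [|u [w [/setIP[uS uA] /setIP[wS wA] fw]]] := fsucc (S :&: A).
  by split; rewrite ?eA ?eB //; apply: side; left.
have [|u' [w' [/setIP[u'S u'A] /setIP[w'S w'A] fw']]] := fsucc (S :&: ~: A).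
  by split; rewrite ?eA ?eB //; apply: side; right.
have ne a b : a \in A -> b \in ~: A -> a != b by move=> aA; rewrite inE; apply: contra => /eqP <-.
have cr a b : a \in A -> b \in ~: A -> cross [set a; b]%SET.
  move=> aA bA; rewrite /cross (_ : _ :&: A = [set a]%SET) ?cards1 //; apply/setP=> z; rewrite !inE.
  case: (eqVneq z a) => [->|] //=; case: (eqVneq z b) => [->|] //= _; move: bA; rewrite inE.
  exact: negbTE.
have mem a b : a \in S -> b \in S -> a != b ->
    [set a; b]%SET \in [set e : {set 'I_n} | (e \subset S) && (#|e| == 2)%N].
  move=> aS bS ab; rewrite inE cards2 ab eqxx andbT.
  by apply/fintype.subsetP=> z; rewrite !inE => /orP[]/eqP->.
(* Both edges have colour [2 * (f u + f u' + 1)], since [w] follows [u] and [w'] follows [u']. *)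
have := inj _ _ (mem u w' uS w'S (ne _ _ uA w'A)) (mem w u' wS u'S (ne _ _ wA u'A)).
rewrite /c !cr // !c2 ?ne // fw fw' addnS addSn => /(_ erefl) eE.
have : u \in [set w; u']%SET by rewrite -eE !inE eqxx.
rewrite !inE (negbTE (ne _ _ uA u'A)) orbF => /eqP uw.
by have := n_Sn (f u); rewrite -fw uw.
Qed.

(** * Expectations over a random subset *)

Section RandomSubset.
Variables (R : realType) (T : finType) (P : {set T}) (p : R).
Implicit Types (E H : {set T}) (F : {set T} -> R).

Definition weight H : R := p ^+ #|H| * (1 - p) ^+ (#|P| - #|H|).

Definition expect F : R := \sum_(H : {set T} | H \subset P) weight H * F H.

Lemma expect_subset E : E \subset P -> expect (fun H => (E \subset H)%:R) = p ^+ #|E|.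
Proof.
move=> EP.
(* [f e] and [g e] are the factors for [e] chosen or not chosen. As [f] vanishes off [P] and [g] on
   [E], expanding the product of [f e + g e] leaves exactly the sets between [E] and [P]. *)
pose f e : R := if e \in P then p else 0.
pose g e : R := if e \in P then (if e \in E then 0 else 1 - p) else 1.
have -> : p ^+ #|E| = \prod_e (f e + g e).
  rewrite -prodr_const [LHS]big_mkcond /=; apply: eq_bigr => e _; rewrite /f /g.
  case: (boolP (e \in E)) => [/(fintype.subsetP EP)->|_]; first by rewrite addr0.
  by case: (e \in P); [ring | rewrite add0r].
rewrite bigA_distr /expect big_mkcond /=; apply: eq_bigr => H _.
case: ifP => [HP|/negbT HP]; last first.
  have /fintype.subsetPn[e eH eP] := HP.
  by rewrite (bigD1 e) //= eH /f (negbTE eP) mul0r.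
have [EH|/fintype.subsetPn[e eE eH]] := boolP (E \subset H); last first.
  by rewrite (bigD1 e) //= (negbTE eH) /g (fintype.subsetP EP _ eE) eE mul0r mulr0.
rewrite mulr1 /weight (bigID (mem H)) /=; congr (_ * _).
  rewrite -prodr_const; apply: eq_bigr => e eH.
  by rewrite eH /f (fintype.subsetP HP _ eH).
have -> : (#|P| - #|H| = #|P :\: H|)%N.
  by rewrite cardsD (finset.setIidPr HP).
rewrite -prodr_const big_mkcond [RHS]big_mkcond /=; apply: eq_bigr => e _.
rewrite inE /g; case: (boolP (e \in H)) => //= eH; case: ifP => // eP.
by case: ifP => // eE; move: eH; rewrite (fintype.subsetP EH _ eE).
Qed.

Lemma expect1 : expect (fun=> 1) = 1.
Proof.
rewrite -[RHS](expr0 p) -[X in p ^+ X](@cards0 T) -expect_subset ?finset.sub0set //.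
by apply: eq_bigr => H _; rewrite finset.sub0set.
Qed.

Lemma expectD F G : expect (fun H => F H + G H) = expect F + expect G.
Proof. by rewrite -big_split /=; apply: eq_bigr => H _; rewrite mulrDr. Qed.

Lemma expectZ a F : expect (fun H => a * F H) = a * expect F.
Proof. by rewrite [RHS]mulr_sumr; apply: eq_bigr => H _; rewrite mulrCA. Qed.

Lemma expect_sum (I : finType) (Q : pred I) (F : I -> {set T} -> R) :
  expect (fun H => \sum_(i | Q i) F i H) = \sum_(i | Q i) expect (F i).
Proof. by rewrite exchange_big /=; apply: eq_bigr => H _; rewrite mulr_sumr. Qed.

Hypothesis p01 : 0 <= p <= 1.

Lemma weight_ge0 H : 0 <= weight H.
Proof. by case/andP: p01 => p0 p1; rewrite mulr_ge0 // exprn_ge0 // subr_ge0. Qed.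

Lemma le_expect F G : (forall H, H \subset P -> F H <= G H) -> expect F <= expect G.
Proof. by move=> FG; apply: ler_sum => H HP; rewrite ler_wpM2l ?weight_ge0 ?FG. Qed.

End RandomSubset.

Arguments expect {R T} P p F.

(** Markov's inequality in the form used throughout: the indicator of [Q] plus [Z] is at least 1
    everywhere. *)
Lemma Gnp_prob_ge (R : realType) n (p : R) (Q : {set {set 'I_n}} -> Prop) (Z : {set {set 'I_n}} -> R) :
  0 <= p <= 1 -> (forall H : {set {set 'I_n}}, H \subset pairs n -> 0 <= Z H) ->
  (forall H : {set {set 'I_n}}, H \subset pairs n -> ~ Q H -> 1 <= Z H) ->
  1 - expect (pairs n) p Z <= Gnp_prob p Q <= 1.
Proof.
move=> p01 Z0 Z1.
have -> : Gnp_prob p Q = expect (pairs n) p (fun H => (`[< Q H >])%:R).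
  rewrite /Gnp_prob /expect big_mkcondr /=; apply: eq_bigr => H _.
  by rewrite /weight; case: asboolP => _; rewrite ?mulr1 ?mulr0.
rewrite lerBlDr -expectD -[X in X <= _ <= _](expect1 (pairs n) p) -[X in _ && (_ <= X)](expect1 (pairs n) p).
apply/andP; split; apply: le_expect => // H HP; case: asboolP => QH //=.
- by rewrite lerDl Z0.
- by rewrite add0r Z1.
Qed.

Definition edges_in n (H : {set {set 'I_n}}) (S : {set 'I_n}) := [set e in H | e \subset S].

Lemma adjacentE n (H : {set {set 'I_n}}) x y : H \subset pairs n -> adjacent H x y = ([set x; y] \in H).
Proof.
move=> /fintype.subsetP HP; rewrite /adjacent; apply/andb_idl => /HP.
by rewrite inE cards2; case: (x != y).
Qed.

Lemma arcs_edges n (H : {set {set 'I_n}}) (S : {set 'I_n}) :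
  H \subset pairs n -> arcs (adjacent H) S = (2 * #|edges_in H S|)%N.
Proof.
move=> HP; transitivity (\sum_(x in S) #|[set e in edges_in H S | x \in e]|)%N.
  apply: eq_bigr => x xS.
  have -> : (\sum_(y in S) adjacent H x y = #|nbrs (adjacent H) x S|)%N.
    rewrite -sum1_card big_mkcond [RHS]big_mkcond /=; apply: eq_bigr => y _; rewrite inE.
    by case: (y \in S) => //=; case: adjacent.
  rewrite -(card_in_imset (f := fun y => [set x; y])); last first.
    move=> y z; rewrite !inE /adjacent => /and3P[_ xy _] /and3P[_ xz _] e.
    have : y \in [set x; z] by rewrite -e !inE eqxx orbT.
    by rewrite !inE eq_sym (negbTE xy) => /eqP.
  apply: eq_card => e; apply/imsetP/idP => [[y]|].
    rewrite inE => /andP[yS /andP[_ eH]] ->; rewrite !inE eqxx eH /= andbT; apply/fintype.subsetP => z.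
    by rewrite !inE => /orP[]/eqP->.
  rewrite !inE => /andP[/andP[eH /fintype.subsetP eS] xe].
  have /(fintype.subsetP HP) := eH; rewrite inE (cardsD1 x) xe => /eqP [] /eqP/cards1P[y ey].
  have ee : e = [set x; y] by rewrite -(finset.setD1K xe) ey.
  by exists y => //; rewrite inE adjacentE // -ee eH eS // ee !inE eqxx orbT.
have -> : (\sum_(x in S) #|[set e in edges_in H S | x \in e]| =
           \sum_(e in edges_in H S) \sum_(x in S | x \in e) 1)%N.
  under eq_bigr do rewrite -sum1_card.
  rewrite (exchange_big_dep (mem (edges_in H S))) /=; last by move=> x e _; rewrite inE => /andP[].
  by apply: eq_bigr => e eE; apply: eq_bigl => x; congr (_ && _); rewrite [LHS]inE eE.
rewrite mulnC -sum_nat_const; apply: eq_bigr => e; rewrite inE => /andP[/(fintype.subsetP HP)].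
rewrite inE => /eqP <- /fintype.subsetP eS; rewrite sum1_card; apply: eq_card => x.
by rewrite unfold_in; apply/andb_idl/eS.
Qed.

(** * First moment of dense vertex sets *)

Section FirstMoment.
Variables (R : realType) (n K : nat) (eps : R).
Hypotheses (n1 : (0 < n)%N) (K5 : (5 < K)%N) (eps0 : 0 < eps) (epsK : 1 + eps <= eps * (K%:R - 2)).

Let p : R := n%:R `^ (- (2 / 3 + eps)).

(** A nonempty set spanning [m] edges that violates one of the two sparseness hypotheses of
    [sparse_cut_not_rbw]. *)
Definition dense_spot (S : {set 'I_n}) (m : nat) :=
  [&& S != finset.set0, #|S| <= K & (3 * #|S| <= 2 * m) || (K <= #|S|.+1) && (3 * #|S| <= 2 * m + 3)]%N.

Definition dense_spots (H : {set {set 'I_n}}) : R :=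
  \sum_(S : {set 'I_n} | (#|S| <= K)%N) \sum_(E : {set {set 'I_n}} |
     (E \subset pairs n) && (E \subset powerset S) && dense_spot S #|E|) (E \subset H)%:R.

(** The claim is that (2/3 + eps) m is at least |S| + eps. If 3|S| is at most 2m, then 2m/3 supplies
    |S| and m >= 1 supplies eps. Otherwise 2m/3 falls short of |S| by at most 1, while m >= K - 2,
    so [epsK] gives eps m >= 1 + eps. *)
Lemma dense_spot_weight (S : {set 'I_n}) m :
  dense_spot S m -> p ^+ m <= (n%:R ^+ #|S|)^-1 * (n%:R `^ eps)^-1.
Proof.
case/and3P => S0 SK Hm; have n0 : (0 : R) < n%:R by rewrite ltr0n.
rewrite -powR_mulrn ?powR_ge0 // -powRrM -invfM -powR_mulrn ?ler0n //.
rewrite -powRD; last by rewrite (gt_eqF n0) implybT.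
rewrite -powRN; apply: ler_powR; first by rewrite ler1n.
rewrite mulNr lerN2.
have v1 : (1 : R) <= #|S|%:R by rewrite ler1n card_gt0.
case/orP: Hm => [Hm|/andP[KS Hm]].
  have : (3 * #|S|)%:R <= (2 * m)%:R :> R by rewrite ler_nat.
  rewrite !natrM => Hm'; have : 0 <= eps * (m%:R - 1) by rewrite mulr_ge0 ?(ltW eps0) //; lra.
  by lra.
have : (3 * #|S|)%:R <= (2 * m + 3)%:R :> R by rewrite ler_nat.
have : K%:R <= #|S|.+1%:R :> R by rewrite ler_nat.
rewrite natrD !natrM -natr1 => KS' Hm'; have K6 : (6 : R) <= K%:R by rewrite ler_nat.
have : 1 + eps <= eps * m%:R.
  by rewrite (le_trans epsK) // ler_wpM2l ?(ltW eps0) //; lra.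
by rewrite mulrDl; lra.
Qed.

(** There are at most n^v sets of size v, so each of the [K.+1] sizes contributes at most 1. *)
Lemma sum_small_sets :
  \sum_(S : {set 'I_n} | (#|S| <= K)%N) (n%:R ^+ #|S|)^-1 <= K.+1%:R :> R.
Proof.
rewrite (partition_big (fun S : {set 'I_n} => inord #|S| : 'I_K.+1) predT) //=.
apply: (@le_trans _ _ (\sum_(v < K.+1) 1)); last by rewrite sumr_const card_ord.
apply: ler_sum => v _.
rewrite (eq_bigl (fun S => S \in [set S : {set 'I_n} | #|S| == v])); last first.
  move=> S; rewrite inE; apply/andP/eqP => [[SK /eqP <-]|Sv]; first by rewrite inordK.
  by rewrite Sv -ltnS ltn_ord; split=> //; apply/eqP/val_inj; rewrite /= inordK.
rewrite (eq_bigr (fun=> (n%:R ^+ v)^-1)); last by move=> S; rewrite inE => /eqP->.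
rewrite sumr_const card_draws card_ord -[_ *+ _]mulr_natl ler_pdivrMr ?exprn_gt0 ?ltr0n // mul1r -natrX ler_nat.
apply: (@leq_trans (n ^_ v)); first by rewrite -bin_ffact leq_pmulr // fact_gt0.
by rewrite ffact_prod -[X in (_ <= _ ^ X)%N]card_ord -prod_nat_const; apply: leq_prod => i _; apply: leq_subr.
Qed.

Lemma expect_dense_spots : 0 <= p <= 1 ->
  expect (pairs n) p dense_spots <= (2 ^ (2 ^ K))%:R * K.+1%:R / n%:R `^ eps.
Proof.
move=> p01; rewrite /dense_spots expect_sum mulrAC mulrC.
apply: le_trans (ler_wpM2r _ sum_small_sets); last by rewrite divr_ge0 ?powR_ge0 ?ler0n.
rewrite mulr_suml; apply: ler_sum => S SK; rewrite expect_sum.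
(* Letting [E] be any family of subsets of [S] costs only the constant factor [2 ^ (2 ^ K)]. *)
apply: (@le_trans _ _ (\sum_(E in powerset (powerset S)) (n%:R ^+ #|S|)^-1 * (n%:R `^ eps)^-1)).
  rewrite big_mkcond [leRHS]big_mkcond /=; apply: ler_sum => E _; rewrite [E \in _]inE.
  case: ifP => [/andP[/andP[EP ES] d]|_].
    by rewrite ES expect_subset //; apply: dense_spot_weight.
  by case: ifP => // _; rewrite mulr_ge0 ?invr_ge0 ?exprn_ge0 ?powR_ge0 ?ler0n.
rewrite sumr_const !card_powerset -[leLHS]mulr_natl mulrCA.
rewrite ler_wpM2l ?invr_ge0 ?exprn_ge0 ?ler0n // ler_wpM2r ?invr_ge0 ?powR_ge0 //.
by rewrite ler_nat !leq_exp2l.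
Qed.

Lemma dense_spots_ge0 H : 0 <= dense_spots H.
Proof. by apply: sumr_ge0 => S _; apply: sumr_ge0. Qed.

Lemma dense_spots_ge1 (H : {set {set 'I_n}}) (S : {set 'I_n}) :
  H \subset pairs n -> dense_spot S #|edges_in H S| -> 1 <= dense_spots H.
Proof.
move=> HP d; have /and3P[_ SK _] := d.
rewrite /dense_spots (bigD1 S) //= (bigD1 (edges_in H S)) /=; last first.
  rewrite d andbT; apply/andP; split; apply/fintype.subsetP => e; rewrite inE => /andP[eH eS].
    exact: (fintype.subsetP HP).
  by rewrite inE.
have -> : edges_in H S \subset H by apply/fintype.subsetP => e; rewrite inE => /andP[].
rewrite -addrA lerDl addr_ge0 //; first exact: sumr_ge0.
by apply: sumr_ge0 => T _; apply: sumr_ge0.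
Qed.

Lemma cut_not_rbw_prob (A : {set 'I_n}) : 0 <= p <= 1 ->
  1 - (2 ^ (2 ^ K))%:R * K.+1%:R / n%:R `^ eps <= Gnp_prob p (fun H => ~ rbw_K6 (cut A :|: H)).
Proof.
move=> p01; apply: (@le_trans _ _ (1 - expect (pairs n) p dense_spots)).
  by rewrite lerB // expect_dense_spots.
apply: (proj1 (andP (Gnp_prob_ge p01 _ _))) => [H _|H HP nQ]; first exact: dense_spots_ge0.
rewrite leNgt; apply/negP => lt1; apply: nQ.
have nd S : ~ dense_spot S #|edges_in H S|.
  by move=> d; move: (dense_spots_ge1 HP d); rewrite leNgt lt1.
apply: (sparse_cut_not_rbw K5 HP) => S.
- move=> S0 SK; rewrite ltnNge; apply/negP => H3; apply: (nd S); apply/and3P; split=> //.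
  by rewrite (leq_trans H3) // arcs_edges.
- move=> SK KS; rewrite ltnNge; apply/negP => H3; apply: (nd S); apply/and3P; split=> //.
    by rewrite -card_gt0 -ltnS; apply: leq_trans KS; apply: leq_trans K5.
  by apply/orP; right; rewrite KS (leq_trans H3) // leq_add2r arcs_edges.
Qed.

End FirstMoment.

(** * The density of the balanced complete bipartite graph *)

Lemma card_cut n (A : {set 'I_n}) : (#|A| * #|~: A| <= #|cut A|)%N.
Proof.
rewrite -cardsX -(card_in_imset (f := fun z : 'I_n * 'I_n => [set z.1; z.2])); last first.
  move=> [a b] [a' b']; rewrite !finset.in_setX /= !inE => /andP[aA bA] /andP[a'A b'A] e.
  have : a \in [set a'; b'] by rewrite -e !inE eqxx.
  have : b \in [set a'; b'] by rewrite -e !inE eqxx orbT.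
  rewrite !inE => /orP[/eqP bb|/eqP->]; first by rewrite -bb (negbTE bA) in a'A.
  by move=> /orP[/eqP->//|/eqP aa]; rewrite -aa aA in b'A.
apply/subset_leq_card/fintype.subsetP => e /imsetP[[a b]]; rewrite finset.in_setX /= [b \in _]inE => /andP[aA bA] ->.
have ab : a != b by apply: contra bA => /eqP <-.
rewrite !inE cards2 ab eqxx /= (_ : _ :&: A = [set a]) ?cards1 //; apply/setP => z; rewrite !inE.
case: (eqVneq z a) => [->|] //=; case: (eqVneq z b) => [->|] //= _; exact: negbTE.
Qed.

Lemma dense_balanced_cut (R : realType) (d : R) n : d <= 1 / 2 ->
  dense_graph d (cut [set i : 'I_n | (i < n./2)%N]).
Proof.
move=> d2; split; first by apply/fintype.subsetP => e; rewrite inE => /andP[].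
set A := [set i : 'I_n | _].
have cA : #|A| = n./2.
  have h : (n./2 <= n)%N by rewrite -[leqRHS]odd_double_half -addnn addnA leq_addl.
  have inj : injective (widen_ord h) by move=> i j /(congr1 val) /= /val_inj.
  rewrite -[RHS]card_ord -(card_imset _ inj).
  apply: eq_card => i; rewrite inE; apply/idP/imsetP => [ih|[j _ ->]]; last exact: (ltn_ord j).
  by exists (Ordinal ih) => //; apply/val_inj.
have cA' : #|~: A| = (n - n./2)%N by rewrite cardsCs finset.setCK cA card_ord.
have := card_cut A; rewrite cA cA' => le.
have key : ('C(n, 2) <= 2 * (n./2 * (n - n./2)))%N.
  by rewrite bin2 -{1 2 4}(odd_double_half n) ; case: (odd n); nia.
apply: (@le_trans _ _ (1 / 2 * 'C(n, 2)%:R)); first by rewrite ler_wpM2r.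
have : ('C(n, 2)%:R : R) <= (2 * #|cut A|)%:R by rewrite ler_nat (leq_trans key) // leq_mul2l.
by rewrite natrM; lra.
Qed.

(** * Rainbow copies of K_6 above the threshold *)

(** A fibre of size a satisfies a <= lam + a^2 / lam, and the squares of the fibre sizes sum to the
    number of colliding pairs. The result is linear in that number, whose expectation is
    accessible. *)
Lemma fiber_bound (R : realType) (A W : finType) (D : {set A}) (f : A -> W) (B : {set W}) (lam : R) :
  0 < lam ->
  #|[set x in D | f x \in B]|%:R <=
  lam * #|B|%:R + lam^-1 * #|[set z : A * A | [&& z.1 \in D, z.2 \in D & f z.1 == f z.2]]|%:R.
Proof.
move=> lam0; pose a w : nat := #|[set x in D | f x == w]|.
have -> : #|[set x in D | f x \in B]| = (\sum_(w in B) a w)%N.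
  rewrite -sum1_card (partition_big f (mem B)) /=; last by move=> x; rewrite inE => /andP[].
  apply: eq_bigr => w wB; rewrite /a -sum1_card; apply: eq_bigl => x; rewrite !inE.
  by case: eqP => [->|]; rewrite ?wB ?andbF ?andbT.
have -> : #|[set z : A * A | [&& z.1 \in D, z.2 \in D & f z.1 == f z.2]]| = (\sum_w a w ^ 2)%N.
  rewrite -sum1_card (partition_big (fun z => f z.1) predT) //=; apply: eq_bigr => w _.
  rewrite -mulnn /a -cardsX -sum1_card; apply: eq_bigl => z; rewrite !inE.
  case: (z.1 \in D); case: (z.2 \in D); rewrite //= ?andbF //.
  by case: (eqVneq (f z.1) w) => [->|]; rewrite ?andbF ?andbT //= eq_sym.
rewrite !natr_sum -sum1_card natr_sum !mulr_sumr.
apply: (@le_trans _ _ (\sum_(w in B) (lam + lam^-1 * (a w ^ 2)%:R))).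
  apply: ler_sum => w _; rewrite -(ler_pM2l lam0) mulrDr mulrA divff ?gt_eqF // mul1r natrX.
  by have := sqr_ge0 (lam - (a w)%:R); have : 0 <= lam * (a w)%:R :> R; [rewrite mulr_ge0 ?ler0n ?ltW | nra].
rewrite big_split /= lerD //; first by apply: ler_sum => w _; rewrite mulr1.
by rewrite [leRHS](bigID (mem B)) /= lerDl sumr_ge0 // => w _; rewrite mulr_ge0 ?ler0n ?invr_ge0 ?(ltW lam0).
Qed.

(** Ordered triples count each triangle six times, but sums over them factor over the
    coordinates. *)
Notation triples n := {ffun 'I_3 -> 'I_n}.

Definition img n (t : triples n) : {set 'I_n} := [set t i | i : 'I_3].
Definition pairs_of n (U : {set 'I_n}) := [set e : {set 'I_n} | (e \subset U) && (#|e| == 2)%N].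
Definition htri n (H : {set {set 'I_n}}) : {set triples n} :=
  [set t : triples n | injectiveb t && (pairs_of (img t) \subset H)].
Definition joined n (G : {set {set 'I_n}}) (t x : triples n) :=
  [forall i, forall j, [set t i; x j] \in G].
Definition k33 n (G : {set {set 'I_n}}) : {set triples n * triples n} :=
  [set z : triples n * triples n | [&& injectiveb z.1, injectiveb z.2 & joined G z.1 z.2]].
(** Each hit spans a [K_6] of the union of [G] and [H]. *)
Definition hits n (G H : {set {set 'I_n}}) : {set triples n * triples n} :=
  [set z in k33 G | (z.1 \in htri H) && (z.2 \in htri H)].
Definition collisions n (W : finType) (f : triples n -> W) (H : {set {set 'I_n}}) :=
  [set z : triples n * triples n | [&& z.1 \in htri H, z.2 \in htri H & f z.1 == f z.2]].

Lemma htri_edge n (H : {set {set 'I_n}}) (t : triples n) i j :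
  t \in htri H -> i != j -> [set t i; t j] \in H.
Proof.
rewrite inE => /andP[/injectiveP inj /fintype.subsetP tH] ij; apply: tH.
rewrite inE cards2 (inj_eq inj) ij andbT; apply/fintype.subsetP=> v; rewrite !inE.
by case/orP => /eqP ->; apply: imset_f.
Qed.

Lemma card_img n (t : triples n) : injectiveb t -> #|img t| = 3%N.
Proof. by move=> /injectiveP inj; rewrite card_imset // card_ord. Qed.

Lemma joinedC n (G : {set {set 'I_n}}) (t x : triples n) : joined G t x = joined G x t.
Proof.
by apply/forallP/forallP => h i; apply/forallP => j; rewrite finset.setUC; apply: (forallP (h j)).
Qed.

(** * A colouring without rainbow K_6 allows few hits *)

Section FewHits.
Variables (R : realType) (n : nat) (G H : {set {set 'I_n}}) (c : {set 'I_n} -> nat).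
Hypotheses (GP : G \subset pairs n) (HP : H \subset pairs n).
Hypotheses (prop : proper_colouring (G :|: H) c) (norbw : ~ has_rainbow_K6 (G :|: H) c).

Lemma colour_star a u w : [set a; u] \in G :|: H -> [set a; w] \in G :|: H ->
  c [set a; u] = c [set a; w] -> u = w.
Proof.
move=> uG wG cE; apply/eqP; rewrite eq_sym; apply/negPn/negP => uw.
have pr e : e \in G :|: H -> #|e| = 2%N.
  rewrite inE => /orP[/(fintype.subsetP GP)|/(fintype.subsetP HP)]; by rewrite inE => /eqP.
have aw : a != w by move: (pr _ wG); rewrite cards2; case: (a != w).
have ne : [set a; u] != [set a; w].
  apply/eqP => e; have : w \in [set a; u] by rewrite e !inE eqxx orbT.
  by rewrite !inE (negbTE uw) orbF eq_sym (negbTE aw).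
have nd : ~~ [disjoint [set a; u] & [set a; w]].
  by apply/pred0Pn; exists a; rewrite /= !inE eqxx.
by have := prop uG wG ne nd; rewrite cE eqxx.
Qed.

Lemma disjoint_img t x : joined G t x -> [disjoint img t & img x].
Proof.
move=> /forallP tx; apply/pred0Pn => -[v /andP[/= /imsetP[i _ vi] /imsetP[j _ vj]]].
have /(fintype.subsetP GP) := forallP (tx i) j.
by rewrite inE -vi -vj cards2 eqxx.
Qed.

Lemma pairs_of_img (t x : triples n) e : e \in pairs_of (img t :|: img x) ->
  [\/ exists i j, i != j /\ e = [set t i; t j],
      exists i j, i != j /\ e = [set x i; x j] |
      exists i j, e = [set t i; x j] ].
Proof.
rewrite inE => /andP[/fintype.subsetP eS /cards2P[a [b [ab ee]]]].
have : a \in img t :|: img x by apply: eS; rewrite ee !inE eqxx.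
have : b \in img t :|: img x by apply: eS; rewrite ee !inE eqxx orbT.
rewrite !inE => /orP[]/imsetP[j _ bj] /orP[]/imsetP[i _ ai].
- by constructor 1; exists i, j; rewrite ee ai bj; split=> //; apply: contra ab => /eqP ij; rewrite ai bj ij.
- by constructor 3; exists j, i; rewrite ee ai bj finset.setUC.
- by constructor 3; exists i, j; rewrite ee ai bj.
- by constructor 2; exists i, j; rewrite ee ai bj; split=> //; apply: contra ab => /eqP ij; rewrite ai bj ij.
Qed.

Implicit Types (q : 'I_3 * 'I_3 * 'I_3 * 'I_3) (z : triples n * triples n).

(** The clashes are sorted by the number of edges running between the two triangles: none, one or
    two. With [k != l] the positions of [z.2] form an index pair of [edge_collisions]. *)
Definition clash_inner q z := let: (i, j, k, l) := q in
  (k != l) && (c [set z.1 i; z.1 j] == c [set z.2 k; z.2 l]).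
Definition clash_mixed q z := let: (i, j, k, l) := q in
  c [set z.1 i; z.1 j] == c [set z.1 k; z.2 l].
Definition clash_cross q z := let: (i, j, k, l) := q in
  (k != l) && (c [set z.1 i; z.2 k] == c [set z.1 j; z.2 l]).
Definition swap z := (z.2, z.1).

(** Two edges of equal colour in the [K_6] are disjoint by properness. A triangle has no two
    disjoint edges, so only the listed clashes remain. *)
Lemma hit_clash z : z \in hits G H -> exists q,
  [|| clash_inner q z, clash_mixed q z, clash_mixed q (swap z) | clash_cross q z].
Proof.
case: z => t x; rewrite !inE /= => /andP[/and3P[injt injx tx] /andP[tH xH]].
have tT : t \in htri H by rewrite inE.
have xT : x \in htri H by rewrite inE.
have dtx := disjoint_img tx.
have cS : #|img t :|: img x| = 6%N.
  by rewrite cardsU !card_img // (_ : img t :&: img x = finset.set0) ?cards0 //; apply/eqP; rewrite setI_eq0.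
apply: contrapT => noq; apply: norbw; exists (img t :|: img x); split=> //.
have SG e : e \in pairs_of (img t :|: img x) -> e \in G :|: H.
  move=> /pairs_of_img[[i [j [ij ->]]]|[i [j [ij ->]]]|[i [j ->]]]; rewrite inE.
  - by rewrite (htri_edge tT ij) orbT.
  - by rewrite (htri_edge xT ij) orbT.
  - by move/forallP: tx => /(_ i)/forallP ->.
split; first by move=> e eS ce; apply: SG; rewrite inE eS ce.
move=> e f eS fS ce; apply/eqP/negPn/negP => ef.
have def : [disjoint e & f].
  by apply/negPn/negP => nd; have := prop (SG e eS) (SG f fS) ef nd; rewrite ce eqxx.
have card3 (y : triples n) i j k l : i != j -> k != l -> injectiveb y ->
    ~ [disjoint [set y i; y j] & [set y k; y l]].
  move=> ij kl injy d; have : (#|[set y i; y j] :|: [set y k; y l]| <= #|img y|)%N.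
    apply/subset_leq_card/fintype.subsetP => v; rewrite !inE.
    by case/orP => /orP[]/eqP->; apply: imset_f.
  have /injectiveP inj := injy.
  rewrite cardsU !cards2 !(inj_eq inj) ij kl card_img //.
  by rewrite (_ : _ :&: _ = finset.set0) ?cards0 //; apply/eqP; rewrite setI_eq0.
apply: noq; move: ce def.
case: (pairs_of_img eS) => [[i [j [ij ->]]]|[i [j [ij ->]]]|[i [j ->]]];
case: (pairs_of_img fS) => [[k [l [kl ->]]]|[k [l [kl ->]]]|[k [l ->]]] ce def.
- by case: (card3 t i j k l).
- by exists (i, j, k, l); rewrite /clash_inner /= ce kl eqxx.
- by exists (i, j, k, l); rewrite /clash_mixed /= ce eqxx orbT.
- by exists (k, l, i, j); rewrite /clash_inner /= ce ij eqxx.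
- by case: (card3 x i j k l).
- by exists (i, j, l, k); rewrite /clash_mixed /= ce [[set t k; _]]finset.setUC eqxx !orbT.
- by exists (k, l, i, j); rewrite /clash_mixed /= ce eqxx orbT.
- by exists (k, l, j, i); rewrite /clash_mixed /= -ce [[set t i; _]]finset.setUC eqxx !orbT.
- exists (i, k, j, l); rewrite /clash_cross /= ce eqxx andbT.
  suff -> : j != l by rewrite !orbT.
  apply/eqP => jl; move/pred0P: def => /(_ (x j)); rewrite /= !inE jl !eqxx !orbT //.
Qed.

Variables (lam lam' : R).
Hypotheses (lam0 : 0 < lam) (lam'0 : 0 < lam').

Definition edge_collisions : nat :=
  (\sum_(kl : 'I_3 * 'I_3 | kl.1 != kl.2) #|collisions (fun x : triples n => (x kl.1, x kl.2)) H|)%N.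
Definition vertex_collisions : nat :=
  (\sum_(m : 'I_3) #|collisions (fun x : triples n => x m) H|)%N.

Let b2 : R := lam * n%:R + lam^-1 * edge_collisions%:R.
Let b1 : R := lam' + lam'^-1 * vertex_collisions%:R.

(** Once the first triangle is fixed, a clash restricts the second one alone, through one of its
    edges or vertices. *)
Lemma slice_bound (P : triples n * triples n -> bool) (b : R) : 
  (forall t, t \in htri H -> #|[set x in htri H | joined G t x && P (t, x)]|%:R <= b) ->
  #|[set z in hits G H | P z]|%:R <= #|htri H|%:R * b.
Proof.
move=> bP; rewrite [leRHS]mulr_natl -[leRHS]sumr_const.
apply: le_trans (ler_sum _ bP); rewrite -natr_sum ler_nat.
under [leqRHS]eq_bigr do rewrite -sum1_card; rewrite pair_big_dep /= sum1_card.
apply/subset_leq_card/fintype.subsetP => -[t x] /setIdP[/setIdP[+ /andP[/= tH xH]] Ptx].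
by rewrite inE => /and3P[_ _ tx]; rewrite unfold_in /= tH inE xH tx Ptx.
Qed.

Lemma edge_key_bound k l (B : {set 'I_n * 'I_n}) : k != l ->
  {in B &, injective (fun w => w.1)} ->
  #|[set x in htri H | (x k, x l) \in B]|%:R <= b2.
Proof.
move=> kl inj; apply: le_trans (fiber_bound (htri H) (fun x : triples n => (x k, x l)) B lam0) _.
apply: lerD; rewrite ?ler_pM2l ?invr_gt0 // ler_nat.
  by rewrite -(card_in_imset inj) -[leqRHS]card_ord max_card.
by rewrite /edge_collisions (bigD1 (k, l)) //= leq_addr.
Qed.

Lemma vertex_key_bound m (B : {set 'I_n}) : (#|B| <= 1)%N ->
  #|[set x in htri H | x m \in B]|%:R <= b1.
Proof.
move=> B1; apply: le_trans (fiber_bound (htri H) (fun x : triples n => x m) B lam'0) _.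
apply: lerD; first by rewrite ler_piMr ?(ltW lam'0) // lern1.
rewrite ler_pM2l ?invr_gt0 // ler_nat.
by rewrite /vertex_collisions (bigD1 m) //= leq_addr.
Qed.

Lemma card_hits_inner q : #|[set z in hits G H | clash_inner q z]|%:R <= #|htri H|%:R * b2.
Proof.
case: q => [[[i j] k] l]; apply: slice_bound => t tH.
have [kl|kl] := boolP (k != l); last first.
  rewrite (_ : [set _ in _ | _] = finset.set0) ?cards0; last first.
    by apply/setP => x; rewrite !inE /clash_inner (negbTE kl) !andbF.
  by rewrite /b2 addr_ge0 // mulr_ge0 ?ler0n ?invr_ge0 ?(ltW lam0).
pose B := [set w : 'I_n * 'I_n | ([set w.1; w.2] \in H) && (c [set t i; t j] == c [set w.1; w.2])].
apply: le_trans (edge_key_bound (B := B) kl _).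
  rewrite ler_nat; apply/subset_leq_card/fintype.subsetP => x; rewrite 2!inE => /andP[xH /andP[_ /andP[_ ce]]].
  by rewrite [in X in _ && X]inE xH /= htri_edge.
move=> [u w] [u' w']; rewrite !inE /= => /andP[wH /eqP cw] /andP[wH' /eqP cw'] uu'; move: wH' cw'; rewrite -uu' => wH' cw'.
by congr (_, _); apply: (@colour_star u); rewrite ?inE ?wH ?wH' ?orbT // -cw.
Qed.

(** With [t] fixed, [x k] determines the colour of its edge to [t i], and properness at [t j] then
    determines [x l]; so there are at most [n] keys. *)
Lemma card_hits_cross q : #|[set z in hits G H | clash_cross q z]|%:R <= #|htri H|%:R * b2.
Proof.
case: q => [[[i j] k] l]; apply: slice_bound => t tH.
have [kl|kl] := boolP (k != l); last first.
  rewrite (_ : [set _ in _ | _] = finset.set0) ?cards0; last first.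
    by apply/setP => x; rewrite !inE /clash_cross (negbTE kl) !andbF.
  by rewrite /b2 addr_ge0 // mulr_ge0 ?ler0n ?invr_ge0 ?(ltW lam0).
pose B := [set w : 'I_n * 'I_n | ([set t j; w.2] \in G) && (c [set t i; w.1] == c [set t j; w.2])].
apply: le_trans (edge_key_bound (B := B) kl _).
  rewrite ler_nat; apply/subset_leq_card/fintype.subsetP => x; rewrite 2!inE => /andP[xH /andP[tx /andP[_ ce]]].
  by rewrite [in X in _ && X]inE xH ce /= andbT; apply: (forallP (forallP tx j) l).
move=> [u w] [u' w']; rewrite !inE /= => /andP[wH /eqP cw] /andP[wH' /eqP cw'] uu'; move: cw'; rewrite -uu' => cw'.
by congr (_, _); apply: (@colour_star (t j)); rewrite ?inE ?wH ?wH' // -cw.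
Qed.

(** The colour is that of an edge of [t], so properness at [t k] leaves at most one place for
    [x l]. *)
Lemma card_hits_mixed q : #|[set z in hits G H | clash_mixed q z]|%:R <= #|htri H|%:R * b1.
Proof.
case: q => [[[i j] k] l]; apply: slice_bound => t tH.
pose B := [set y | ([set t k; y] \in G) && (c [set t i; t j] == c [set t k; y])].
apply: le_trans (vertex_key_bound (B := B) l _).
  rewrite ler_nat; apply/subset_leq_card/fintype.subsetP => x; rewrite 2!inE => /andP[xH /andP[tx ce]].
  by rewrite [in X in _ && X]inE xH /=; apply/andP; split=> //; apply: (forallP (forallP tx k) l).
apply/card_le1_eqP => u w; rewrite !inE => /andP[uG /eqP cu] /andP[wG /eqP cw].
by apply: (@colour_star (t k)); rewrite ?inE ?uG ?wG // -cu.
Qed.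

Lemma card_hits_mixed_swap q :
  #|[set z in hits G H | clash_mixed q (swap z)]|%:R <= #|htri H|%:R * b1.
Proof.
apply: le_trans (card_hits_mixed q); have swapK : cancel swap swap by case.
rewrite ler_nat -(card_imset _ (can_inj swapK)); apply/subset_leq_card/fintype.subsetP => _ /imsetP[[t x] + ->].
by rewrite !inE /= joinedC => /andP[/andP[/and3P[-> -> ->] /andP[-> ->]] ->].
Qed.

(** There are 81 index quadruples, each with two kinds of clash bounded through [b2] and two through
    [b1], whence 162. *)
Lemma few_hits : #|hits G H|%:R <= 162 * #|htri H|%:R * (b2 + b1).
Proof.
have : (#|hits G H| <= \sum_q (#|[set z in hits G H | clash_inner q z]| +
    #|[set z in hits G H | clash_mixed q z]| + #|[set z in hits G H | clash_mixed q (swap z)]| +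
    #|[set z in hits G H | clash_cross q z]|))%N.
  apply: (@leq_trans (\sum_q #|[set z in hits G H | [|| clash_inner q z, clash_mixed q z, clash_mixed q (swap z) | clash_cross q z]]|)%N).
    under eq_bigr do rewrite -sum1_card; rewrite -sum1_card.
    rewrite (exchange_big_dep (mem (hits G H))) /=; last by move=> q z _; rewrite inE => /andP[].
    apply: leq_sum => z zh; have [q hq] := hit_clash zh.
    by rewrite (bigD1 q) /= ?leq_addr // inE zh.
  apply: leq_sum => q _.
  have U (P Q : pred (triples n * triples n)) : (#|[set z in hits G H | P z || Q z]| <=
      #|[set z in hits G H | P z]| + #|[set z in hits G H | Q z]|)%N.
    rewrite -cardsUI (_ : [set z in hits G H | P z || Q z] = [set z in hits G H | P z] :|: [set z in hits G H | Q z]) ?leq_addr //.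
    by apply/setP => z; rewrite !inE -andb_orr.
  rewrite -!addnA; do 2 (apply: leq_trans (U _ _) _; rewrite leq_add2l).
  exact: U.
rewrite -(ler_nat R) => /le_trans; apply; rewrite natr_sum.
apply: (@le_trans _ _ (\sum_q (2 * #|htri H|%:R * (b2 + b1)))).
  apply: ler_sum => q _; rewrite !natrD.
  have := card_hits_inner q; have := card_hits_cross q; have := card_hits_mixed q.
  have := card_hits_mixed_swap q; lra.
rewrite sumr_const !card_prod card_ord -mulr_natl; lra.
Qed.

End FewHits.

(** * Moments of triangle counts *)

Lemma overlap_sum n k (U : {set 'I_n}) : (0 < n)%N ->
  (\sum_(x : {ffun 'I_k -> 'I_n}) n ^ #|[set x i | i : 'I_k] :&: U| <= (n * #|U|.+1) ^ k)%N.
Proof.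
move=> n0; apply: (@leq_trans (\sum_(x : {ffun 'I_k -> 'I_n}) \prod_i n ^ (x i \in U))%N).
  apply: leq_sum => x _; rewrite -expn_sum leq_pexp2l //.
  have -> : (\sum_i (x i \in U) = #|[set i | x i \in U]|)%N.
    by rewrite -sum1_card [RHS]big_mkcond; apply: eq_bigr => i _; rewrite inE; case: (x i \in U).
  apply: leq_trans (leq_imset_card x _); apply/subset_leq_card/fintype.subsetP => v.
  by rewrite inE => /andP[/imsetP[i _ ->] iU]; apply: imset_f; rewrite inE.
rewrite -(bigA_distr_bigA (fun _ v => n ^ (v \in U))%N) prod_nat_const card_ord.
case: k => // k; rewrite leq_exp2r //.
apply: (@leq_trans (\sum_(v : 'I_n) ((v \in U) * n + 1))%N).
  by apply: leq_sum => v _; case: (v \in U); rewrite ?expn1 ?mul1n ?leq_addr.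
rewrite big_split /= -big_distrl /= sum_nat_const card_ord muln1 mulnS addnC mulnC leq_add2l leq_mul2l.
by rewrite -sum1_card [leqRHS]big_mkcond leq_sum ?orbT // => v _; case: (v \in U).
Qed.

Lemma pairs_of_sub n (U : {set 'I_n}) : pairs_of U \subset pairs n.
Proof. by apply/fintype.subsetP => e; rewrite !inE => /andP[]. Qed.

Lemma card_pairs_of n (U : {set 'I_n}) : #|pairs_of U| = 'C(#|U|, 2).
Proof. exact: cards_draws. Qed.

Lemma pairs_ofI n (U W : {set 'I_n}) : pairs_of U :&: pairs_of W = pairs_of (U :&: W).
Proof.
by apply/setP => e; rewrite !inE finset.subsetI; case: (e \subset U); case: (e \subset W); case: eqP.
Qed.

Lemma bin2_le3 m : (m <= 3)%N -> (2 * 'C(m, 2) <= 3 * m.-1)%N.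
Proof. by case: m => [|[|[|[|m]]]]. Qed.

Section Moments.
Variables (R : realType) (n : nat) (p : R).
Hypotheses (n0 : (0 < n)%N) (p01 : 0 <= p <= 1).
Let E := @expect R _ (pairs n) p.

Lemma ler_power_slack (L : R) (k v : nat) : 1 <= L -> L ^+ 2 <= n%:R ^+ 2 * p ^+ 3 ->
  (2 * k <= 3 * v)%N -> (0 < v)%N -> L <= p ^+ k * n%:R ^+ v.
Proof.
move=> L1 LM kv v0; case/andP: (p01) => p0 p1.
have pn0 : 0 <= p ^+ k * n%:R ^+ v by rewrite mulr_ge0 ?exprn_ge0 ?ler0n.
rewrite -(ler_pXn2r (n := 2)) ?nnegrE ?(le_trans ler01 L1) //.
apply: (le_trans LM); apply: (@le_trans _ _ ((n%:R ^+ 2 * p ^+ 3) ^+ v)).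
  by rewrite ler_eXnr // (le_trans _ LM) // expr_ge1 // (le_trans ler01).
have -> : (n%:R ^+ 2 * p ^+ 3) ^+ v = p ^+ (3 * v) * n%:R ^+ (2 * v) by rewrite exprMn -!exprM mulrC.
have -> : (p ^+ k * n%:R ^+ v) ^+ 2 = p ^+ (2 * k) * n%:R ^+ (2 * v).
  by rewrite exprMn -!exprM !(mulnC _ 2).
by rewrite ler_wpM2r ?exprn_ge0 ?ler0n // ler_wiXn2l.
Qed.

Lemma expect_htri : E (fun H => #|htri H|%:R) <= n%:R ^+ 3 * p ^+ 3.
Proof.
rewrite /E; have -> : expect (pairs n) p (fun H => #|htri H|%:R) =
    expect (pairs n) p (fun H => \sum_(t : triples n | injectiveb t) (pairs_of (img t) \subset H)%:R).
  apply: eq_bigr => H _; rewrite -natr_sum -sum1_card big_mkcond [in RHS]big_mkcond /=.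
  by congr (_ * _%:R); apply: eq_bigr => t _; rewrite inE; case: injectiveb => //=; case: (_ \subset _).
rewrite expect_sum (eq_bigr (fun=> p ^+ 3)); last first.
  by move=> t it; rewrite expect_subset ?pairs_of_sub // card_pairs_of card_img.
rewrite sumr_const -[leLHS]mulr_natl ler_wpM2r ?exprn_ge0 ?(proj1 (andP p01)) //.
rewrite -natrX ler_nat (leq_trans (max_card _)) // card_ffun !card_ord //.
Qed.

Lemma expect_collisions (W : finType) (f : triples n -> W) (L : R) :
  1 <= L -> L ^+ 2 <= n%:R ^+ 2 * p ^+ 3 ->
  (forall t x : triples n, injectiveb t -> injectiveb x -> f t = f x ->
     (0 < #|img t :&: img x|)%N /\ (L <= 1 \/ (1 < #|img t :&: img x|)%N)) ->
  n%:R * L * E (fun H => #|collisions f H|%:R) <= 64 * (n%:R ^+ 3 * p ^+ 3) ^+ 2.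
Proof.
move=> L1 LM fm; case/andP: (p01) => p0 p1.
pose C (z : triples n * triples n) := [&& injectiveb z.1, injectiveb z.2 & f z.1 == f z.2].
pose F (z : triples n * triples n) := pairs_of (img z.1) :|: pairs_of (img z.2).
have -> : E (fun H => #|collisions f H|%:R) = E (fun H => \sum_(z | C z) (F z \subset H)%:R).
  apply: eq_bigr => H _; rewrite -natr_sum -sum1_card big_mkcond [in RHS]big_mkcond /=.
  congr (_ * _%:R); apply: eq_bigr => z _; rewrite !inE /C /F finset.subUset.
  by case: injectiveb => //=; case: injectiveb; case: (f _ == f _); case: (_ \subset _) => //=; case: (_ \subset _).
have FP z : F z \subset pairs n by rewrite finset.subUset !pairs_of_sub.
rewrite /E expect_sum mulr_sumr.
apply: (@le_trans _ _ (\sum_(z : triples n * triples n) p ^+ 6 * (n ^ #|img z.2 :&: img z.1|)%:R)).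
  rewrite big_mkcond /=; apply: ler_sum => z _; case: ifP => [/and3P[i1 i2 /eqP fz]|_]; last first.
    by rewrite mulr_ge0 ?exprn_ge0 ?ler0n.
  rewrite expect_subset ?FP //; have [m1 mL] := fm _ _ i1 i2 fz; rewrite finset.setIC in m1 mL.
  set m := #|img z.2 :&: img z.1| in m1 mL *.
  have m3 : (m <= 3)%N by rewrite -(card_img i2) subset_leq_card // finset.subsetIl.
  have Fm : (#|F z| + 'C(m, 2) = 6)%N.
    by rewrite /m finset.setIC -card_pairs_of -pairs_ofI cardsUI !card_pairs_of !card_img.
  have -> : p ^+ 6 = p ^+ #|F z| * p ^+ 'C(m, 2) by rewrite -exprD Fm.
  rewrite natrX mulrC -mulrA ler_wpM2l ?exprn_ge0 // -(prednK m1) exprS mulrCA.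
  rewrite ler_wpM2l ?ler0n // prednK //.
  have [m_le1|m2] := leqP m 1.
    have -> : m = 1%N by apply/eqP; rewrite eqn_leq m_le1.
    by rewrite !expr0 mulr1; case: mL => //; rewrite ltnNge m_le1.
  apply: ler_power_slack => //; first exact: bin2_le3.
  by rewrite -ltnS prednK.
rewrite -mulr_sumr -natr_sum exprMn -!exprM [leRHS]mulrA [leRHS]mulrC.
rewrite ler_wpM2l ?exprn_ge0 // -natrX -natrM ler_nat -(pair_bigA _ (fun t x => n ^ #|img x :&: img t|)%N) /=.
apply: (@leq_trans (\sum_(t : triples n) 64 * n ^ 3)%N); last first.
  by rewrite sum_nat_const card_ffun !card_ord mulnCA -expnD.
apply: leq_sum => t _; apply: leq_trans (overlap_sum 3 (img t) n0) _.
have ct : (#|img t| <= 3)%N by rewrite (leq_trans (leq_imset_card _ _)) // card_ord.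
rewrite expnMn mulnC; apply: leq_mul => //; apply: (@leq_trans (4 ^ 3)) => //.
by rewrite leq_exp2r.
Qed.


Let F (z : triples n * triples n) := pairs_of (img z.1) :|: pairs_of (img z.2).

Variable G : {set {set 'I_n}}.
Hypotheses (np1 : 1 <= n%:R ^+ 2 * p ^+ 3) (GP : G \subset pairs n).
Let V (z : triples n * triples n) := img z.1 :|: img z.2.

Lemma k33_disjoint z : z \in k33 G -> img z.1 :&: img z.2 = finset.set0.
Proof. by rewrite inE => /and3P[_ _ /(disjoint_img GP) d]; apply/eqP; rewrite setI_eq0. Qed.

Lemma card_k33_edges z : z \in k33 G -> #|F z| = 6%N.
Proof.
move=> zk; have := zk; rewrite inE => /and3P[i1 i2 _].
by rewrite cardsU pairs_ofI (k33_disjoint zk) !card_pairs_of !card_img // cards0.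
Qed.

Lemma k33_overlap z w : z \in k33 G -> w \in k33 G ->
  (2 * #|F z :&: F w| <= 3 * (#|img w.1 :&: V z| + #|img w.2 :&: V z|).-1)%N.
Proof.
move=> zk wk; have := zk; have := wk; rewrite !inE => /and3P[w1 w2 _] /and3P[z1 z2 _].
have split3 (w' : triples n) : #|img w' :&: V z| = (#|img w' :&: img z.1| + #|img w' :&: img z.2|)%N.
  by rewrite finset.setIUr cardsU finset.setIACA finset.setIid (k33_disjoint zk) finset.setI0 cards0 subn0.
have m3 (w' z' : triples n) : injectiveb w' -> (2 * 'C(#|img w' :&: img z'|, 2) <= 3 * (#|img w' :&: img z'|).-1)%N.
  by move=> iw; apply: bin2_le3; rewrite -(card_img iw) subset_leq_card // finset.subsetIl.
have : (#|F z :&: F w| <= 'C(#|img w.1 :&: img z.1|, 2) + 'C(#|img w.1 :&: img z.2|, 2) +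
   ('C(#|img w.2 :&: img z.1|, 2) + 'C(#|img w.2 :&: img z.2|, 2)))%N.
  rewrite -!card_pairs_of -!pairs_ofI /F finset.setIC finset.setIUl !finset.setIUr.
  apply: leq_trans (leq_card_setU _ _).1 _.
  by apply: leq_add; apply: (leq_card_setU _ _).1.
have := m3 _ z.1 w1; have := m3 _ z.2 w1; have := m3 _ z.1 w2; have := m3 _ z.2 w2.
rewrite !split3; clear.
move: #|F z :&: F w| #|img w.1 :&: img z.1| #|img w.1 :&: img z.2| #|img w.2 :&: img z.1| #|img w.2 :&: img z.2|.
move=> k a b c d; move: 'C(a, 2) 'C(b, 2) 'C(c, 2) 'C(d, 2) => a' b' c' d'; lia.
Qed.

Lemma sum_k33_overlap z : z \in k33 G ->
  \sum_(w in k33 G) p ^+ #|F z :|: F w| <= p ^+ 12 * (#|k33 G|%:R + 7 ^+ 6 * n%:R ^+ 5).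
Proof.
move=> zk; case/andP: (p01) => p0 p1; have nR : (0 : R) < n%:R by rewrite ltr0n.
pose v w := (#|img w.1 :&: V z| + #|img w.2 :&: V z|)%N.
apply: (@le_trans _ _ (\sum_(w in k33 G) p ^+ 12 * (1 + (n ^ v w)%:R / n%:R))).
  apply: ler_sum => w wk; have kv := k33_overlap zk wk.
  have cU : (#|F z :|: F w| + #|F z :&: F w| = 12)%N by rewrite cardsUI !card_k33_edges.
  rewrite -cU exprD -mulrA ler_peMr ?exprn_ge0 //.
  have [k0|k0] := posnP #|F z :&: F w|.
    by rewrite k0 expr0 mul1r lerDl divr_ge0 ?ler0n.
  have v1 : (0 < (v w).-1)%N by move: kv k0; rewrite -/(v w); clear; case: (v w).-1 => //; lia.
  have := ler_power_slack (lexx 1) _ kv v1; rewrite expr1n => /(_ np1) /le_trans; apply.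
  rewrite ler_wpM2l ?exprn_ge0 // -/(v w) -[in leRHS](prednK (ltnW (n := v w) _)); last by move: v1; case: (v w) => [|[]].
  by rewrite expnS natrM mulrAC divff ?gt_eqF // mul1r natrX lerDr.
rewrite -mulr_sumr ler_wpM2l ?exprn_ge0 // big_split /= sumr_const lerD // -mulr_suml.
rewrite ler_pdivrMr // -mulrA -exprSr -natr_sum -!natrX -natrM ler_nat.
apply: (@leq_trans (\sum_w n ^ v w)%N); first by rewrite big_mkcond leq_sum // => w _; case: ifP.
have cV : (#|V z| <= 6)%N.
  rewrite /V; apply: leq_trans (leq_card_setU _ _).1 _; apply: (@leq_add _ _ 3 3);
  by rewrite (leq_trans (leq_imset_card _ _)) // card_ord.
have le7 : (\sum_(x : triples n) n ^ #|img x :&: V z| <= (n * 7) ^ 3)%N.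
  by apply: leq_trans (overlap_sum 3 (V z) n0) _; rewrite leq_exp2r // leq_mul2l ltnS cV orbT.
rewrite /v -(pair_bigA _ (fun t x => n ^ (#|img t :&: V z| + #|img x :&: V z|))%N) /=.
under eq_bigr do under eq_bigr do rewrite expnD.
under eq_bigr do rewrite -big_distrr /=.
rewrite -big_distrl /= (leq_trans (leq_mul le7 le7)) // -expnD expnMn mulnC //.
Qed.

Lemma variance_hits :
  E (fun H => (#|hits G H|%:R - #|k33 G|%:R * p ^+ 6) ^+ 2) <= p ^+ 12 * #|k33 G|%:R * (7 ^+ 6 * n%:R ^+ 5).
Proof.
set N : R := #|k33 G|%:R.
have hitsE H : #|hits G H|%:R = \sum_(z in k33 G) (F z \subset H)%:R :> R.
  rewrite -natr_sum -sum1_card big_mkcond [in RHS]big_mkcond /=; congr (_%:R); apply: eq_bigr => z _.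
  rewrite !inE; case: injectiveb => //=; case: injectiveb => //=; case: joined => //=.
  by rewrite /F finset.subUset; case: (_ \subset _) => //=; case: (_ \subset _).
have FP z : F z \subset pairs n by rewrite finset.subUset !pairs_of_sub.
have E1 : E (fun H => #|hits G H|%:R) = N * p ^+ 6.
  rewrite /E (_ : expect _ _ _ = expect (pairs n) p (fun H => \sum_(z in k33 G) (F z \subset H)%:R)); last first.
    by apply: eq_bigr => H _; rewrite hitsE.
  rewrite expect_sum (eq_bigr (fun=> p ^+ 6)) ?sumr_const ?mulr_natl // => z zk.
  by rewrite expect_subset ?FP // card_k33_edges.
have E2 : E (fun H => #|hits G H|%:R ^+ 2) <= N * (p ^+ 12 * (N + 7 ^+ 6 * n%:R ^+ 5)).
  rewrite /E (_ : expect _ _ _ = expect (pairs n) p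
      (fun H => \sum_(z in k33 G) \sum_(w in k33 G) (F z :|: F w \subset H)%:R)); last first.
    apply: eq_bigr => H _; rewrite hitsE expr2 mulr_suml; congr (_ * _); apply: eq_bigr => z _.
    by rewrite mulr_sumr; apply: eq_bigr => w _; rewrite (finset.subUset _ (F z) (F w)) -natrM mulnb.
  rewrite expect_sum /N [leRHS]mulr_natl -[leRHS]sumr_const; apply: ler_sum => z zk.
  rewrite expect_sum (eq_bigr (fun w => p ^+ #|F z :|: F w|)); first exact: sum_k33_overlap.
  by move=> w wk; rewrite expect_subset // finset.subUset !FP.
have -> : E (fun H => (#|hits G H|%:R - N * p ^+ 6) ^+ 2) =
    E (fun H => #|hits G H|%:R ^+ 2) - (N * p ^+ 6) ^+ 2.
  rewrite /E (_ : expect _ _ _ = expect (pairs n) p (fun H => #|hits G H|%:R ^+ 2 +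
     (- (2 * (N * p ^+ 6)) * #|hits G H|%:R + (N * p ^+ 6) ^+ 2 * 1))); last first.
    by apply: eq_bigr => H _; congr (_ * _); ring.
  by rewrite !expectD !expectZ expect1 -/E E1; ring.
rewrite lerBlDr (le_trans E2) //; by rewrite le_eqVlt; apply/orP; left; apply/eqP; ring.
Qed.

End Moments.

Lemma power_mean3 (R : realType) (I : finType) (a : I -> R) : (forall i, 0 <= a i) ->
  (\sum_i a i) ^+ 3 <= #|I|%:R ^+ 2 * \sum_i a i ^+ 3.
Proof.
move=> a0; have [I0|I0] := posnP #|I|.
  have Z (F : I -> R) : \sum_i F i = 0 by apply: big1 => i; move: (fintype0 i I0).
  by rewrite !Z expr0n mulr0.
set m : R := #|I|%:R; set S := \sum_i a i; pose s := S / m.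
have m0 : 0 < m by rewrite ltr0n.
have s0 : 0 <= s by rewrite divr_ge0 ?sumr_ge0 ?ltW.
have Sms : S = m * s by rewrite /s mulrC divfK ?gt_eqF.
(* The tangent line of the cube at the mean: a^3 - 3 s^2 a + 2 s^3 = (a - s)^2 (a + 2 s) *)
have tangent i : 3 * s ^+ 2 * a i - 2 * s ^+ 3 <= a i ^+ 3.
  rewrite -subr_ge0 (_ : _ - _ = (a i - s) ^+ 2 * (a i + 2 * s)); last by ring.
  by rewrite mulr_ge0 ?sqr_ge0 // addr_ge0 // mulr_ge0.
have : \sum_i (3 * s ^+ 2 * a i - 2 * s ^+ 3) <= \sum_i a i ^+ 3 by apply: ler_sum.
rewrite big_split /= -mulr_sumr -/S sumr_const -mulr_natl -/m Sms => le.
apply: le_trans (ler_wpM2l (sqr_ge0 m) le); rewrite le_eqVlt; apply/orP; left; apply/eqP; ring.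
Qed.

Lemma joined_count (R : realType) n (G : {set {set 'I_n}}) : (0 < n)%N -> G \subset pairs n ->
  (2 * #|G|%:R) ^+ 9 / n%:R ^+ 12 <= \sum_(t : triples n) \sum_(x : triples n) (joined G t x)%:R :> R.
Proof.
move=> n0 GP; have nR : (0 : R) < n%:R by rewrite ltr0n.
pose g u v : R := ([set u; v] \in G)%:R.
have g0 u v : 0 <= g u v by rewrite ler0n.
have pg0 (t : triples n) v : 0 <= \prod_i g (t i) v by apply: prodr_ge0.
pose A (t : triples n) : R := \sum_v \prod_i g (t i) v.
have degsum : \sum_v \sum_u g u v = 2 * #|G|%:R.
  have := arcs_edges finset.setT GP; rewrite /arcs /edges_in.
  rewrite (_ : [set e in G | _] = G); last by apply/setP => e; rewrite inE finset.subsetT andbT.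
  move=> /(congr1 (fun k => k%:R : R)); rewrite natrM natr_sum => <-.
  rewrite exchange_big /=; apply: eq_big => [u|u _]; first by rewrite inE.
  rewrite natr_sum; apply: eq_big => [v|v _]; first by rewrite inE.
  by rewrite adjacentE.
have joinedE : \sum_(t : triples n) \sum_(x : triples n) (joined G t x)%:R = \sum_t A t ^+ 3.
  apply: eq_bigr => t _; rewrite /A.
  rewrite -[X in _ ^+ X]card_ord -prodr_const (bigA_distr_bigA (fun _ v => \prod_i g (t i) v)) /=.
  apply: eq_bigr => x _; rewrite exchange_big /=.
  have [/forallP jn|/forallPn[i /forallPn[j ij]]] := boolP (joined G t x).
    by rewrite big1 // => i _; rewrite big1 // => j _; rewrite /g (forallP (jn i) j).
  by rewrite (bigD1 i) //= (bigD1 j) //= {1}/g (negbTE ij) !mul0r.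
have sumA : \sum_t A t = \sum_v (\sum_u g u v) ^+ 3.
  rewrite /A exchange_big /=; apply: eq_bigr => v _.
  by rewrite -[X in _ ^+ X]card_ord -prodr_const (bigA_distr_bigA (fun _ u => g u v)).
have := power_mean3 (a := A) (fun t => sumr_ge0 _ (fun v _ => pg0 t v)).
have := power_mean3 (a := fun v => \sum_u g u v) (fun v => sumr_ge0 _ (fun u _ => g0 u v)).
rewrite -sumA degsum joinedE card_ffun !card_ord natrX => le1 le2.
rewrite ler_pdivrMr ?exprn_gt0 //.
rewrite -[9%N]/(3 * 3)%N exprM.
apply: (@le_trans _ _ ((n%:R ^+ 2 * \sum_t A t) ^+ 3)).
  by rewrite ler_pXn2r ?nnegrE ?mulr_ge0 ?exprn_ge0 ?sumr_ge0 ?ler0n // => t _; apply: sumr_ge0.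
rewrite exprMn; apply: le_trans (ler_wpM2l _ le2) _; first by rewrite !exprn_ge0 ?ler0n.
by rewrite le_eqVlt; apply/orP; left; apply/eqP; ring.
Qed.

Lemma k33_lower (R : realType) (d : R) n (G : {set {set 'I_n}}) : (1 < n)%N -> 0 < d ->
  dense_graph d G -> (d / 2) ^+ 9 * n%:R ^+ 6 - 6 * n%:R ^+ 5 <= #|k33 G|%:R.
Proof.
move=> n1 d0 [GP dG]; have nR : (0 : R) < n%:R by rewrite ltr0n ltnW.
have e2 : d / 2 * n%:R ^+ 2 <= 2 * #|G|%:R.
  have : 'C(n, 2)%:R * 2 = n%:R * (n%:R - 1) :> R.
    have := bin_ffact n 2; rewrite ffactnS ffactn1 => /(congr1 (fun k => k%:R : R)).
    by rewrite !natrM -subn1 natrB // ltnW.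
  have n2 : (2 : R) <= n%:R by rewrite ler_nat.
  move=> b2; have : d * (n%:R * (n%:R - 1)) <= 2 * #|G|%:R by rewrite -b2 mulrA; lra.
  have : 0 <= d * (n%:R * (n%:R - 2)) by rewrite mulr_ge0 ?(ltW d0) // mulr_ge0 ?(ltW nR) // subr_ge0.
  lra.
have := joined_count R (ltnW n1) GP => le1.
have le2 : (d / 2) ^+ 9 * n%:R ^+ 6 <= (2 * #|G|%:R) ^+ 9 / n%:R ^+ 12.
  rewrite ler_pdivlMr ?exprn_gt0 //.
  rewrite (_ : _ * _ * _ = (d / 2 * n%:R ^+ 2) ^+ 9); last by ring.
  by rewrite ler_pXn2r ?nnegrE // ?mulr_ge0 ?exprn_ge0 ?divr_ge0 ?ler0n ?ltW.
rewrite lerBlDr (le_trans le2) // (le_trans le1) //.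
pose I : R := \sum_(t : triples n) (~~ injectiveb t)%:R.
have I3 : I <= 3 * n%:R ^+ 2.
  have : I + (n ^_ 3)%:R = n%:R ^+ 3.
    rewrite /I -natr_sum -natrD -natrX; congr (_%:R).
    have -> : (n ^_ 3 = #|[set t : triples n | injectiveb t]|)%N by rewrite card_inj_ffuns !card_ord.
    have -> : (n ^ 3 = #|{: triples n}|)%N by rewrite card_ffun !card_ord.
    rewrite -[X in (_ + X)%N]sum1_card -[RHS]sum1_card [X in (_ + X)%N]big_mkcond -big_split /=.
    by apply: eq_bigr => t _; rewrite inE; case: injectiveb.
  case: n n1 @I {G GP dG nR e2 le1 le2} => [|[|m]] // _ I; rewrite !ffactnS ffactn0 muln1 /= !natrM -!natr1.
  by have : (0 : R) <= m%:R by []; set y : R := m%:R; nra.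
apply: (@le_trans _ _ (\sum_(t : triples n) \sum_(x : triples n)
   (((t, x) \in k33 G)%:R + ((~~ injectiveb t)%:R + (~~ injectiveb x)%:R)))).
  apply: ler_sum => t _; apply: ler_sum => x _; rewrite inE /= -!natrD ler_nat.
  by case: injectiveb; case: injectiveb; case: joined.
under eq_bigr do rewrite !big_split /= sumr_const card_ffun !card_ord -/I.
rewrite !big_split /= sumr_const card_ffun !card_ord sumrMnl -/I; apply: lerD.
  rewrite (pair_bigA _ (fun t x => ((t, x) \in k33 G)%:R)) /= -natr_sum ler_nat -sum1_card [leqRHS]big_mkcond /=.
  by apply: leq_sum => -[t x] _ /=; case: ifP.
rewrite -[_ *+ _]mulr_natl natrX.
have : n%:R ^+ 3 * I <= n%:R ^+ 3 * (3 * n%:R ^+ 2) by rewrite ler_wpM2l ?exprn_ge0 ?ler0n.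
lra.
Qed.

Section ManyHits.
Variables (R : realType) (n : nat) (p L a K lam : R) (G : {set {set 'I_n}}).
Hypotheses (n0 : (0 < n)%N) (p01 : 0 <= p <= 1) (L1 : 1 <= L) (LM : L ^+ 2 <= n%:R ^+ 2 * p ^+ 3).
Hypotheses (a0 : 0 < a) (K0 : 0 < K) (lam0 : 0 < lam) (Klam : 1296 * K * lam <= a).
Hypotheses (GP : G \subset pairs n) (Ga : a * n%:R ^+ 6 <= #|k33 G|%:R).

Let M : R := n%:R ^+ 2 * p ^+ 3.
Let mu : R := n%:R ^+ 3 * p ^+ 3.
Let N : R := #|k33 G|%:R.

Definition defect (H : {set {set 'I_n}}) : R :=
  4 / (N * p ^+ 6) ^+ 2 * (#|hits G H|%:R - N * p ^+ 6) ^+ 2 + (K * mu)^-1 * #|htri H|%:R +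
  ((lam * M) ^+ 2 * n%:R)^-1 * (edge_collisions H)%:R + ((lam * mu) ^+ 2)^-1 * (vertex_collisions H)%:R.

Let nR : (0 : R) < n%:R. Proof. by rewrite ltr0n. Qed.
Let M1 : 1 <= M. Proof. by rewrite (le_trans _ LM) // expr_ge1 // (le_trans ler01). Qed.
Let M0 : 0 < M. Proof. exact: lt_le_trans M1. Qed.
Let p0 : 0 < p.
Proof.
case/andP: p01 => p_ge0 _; rewrite lt_neqAle p_ge0 andbT; apply/eqP => pE.
by move: M0; rewrite /M -pE expr0n mulr0 ltxx.
Qed.
Let muE : mu = n%:R * M. Proof. by rewrite /mu /M; ring. Qed.
Let mu0 : 0 < mu. Proof. by rewrite muE mulr_gt0. Qed.
Let N0 : 0 < N. Proof. by rewrite (lt_le_trans _ Ga) // mulr_gt0 ?exprn_gt0. Qed.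

Lemma defect_ge0 H : 0 <= defect H.
Proof.
rewrite /defect !addr_ge0 // mulr_ge0 ?invr_ge0 ?ler0n ?sqr_ge0 //.
- by rewrite divr_ge0 ?sqr_ge0.
- by rewrite mulr_ge0 ?ltW.
- by rewrite mulr_ge0 ?sqr_ge0 ?ltW.
Qed.

Lemma defect_lt1 (H : {set {set 'I_n}}) : H \subset pairs n -> defect H < 1 -> rbw_K6 (G :|: H).
Proof.
move=> HP lt1 c prop; apply: contrapT => norbw.
have lM0 : 0 < lam * M by rewrite mulr_gt0.
have lmu0 : 0 < lam * mu by rewrite mulr_gt0.
have := few_hits GP HP prop norbw lM0 lmu0.
set X : R := #|hits G H|%:R; set T : R := #|htri H|%:R.
set C2 : R := (edge_collisions H)%:R; set C1 : R := (vertex_collisions H)%:R => few.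
have Np0 : 0 < N * p ^+ 6 by rewrite mulr_gt0 ?exprn_gt0.
have d1 : 0 <= 4 / (N * p ^+ 6) ^+ 2 * (X - N * p ^+ 6) ^+ 2.
  by rewrite mulr_ge0 ?sqr_ge0 // divr_ge0 ?sqr_ge0.
have d2 : 0 <= (K * mu)^-1 * T by rewrite mulr_ge0 ?ler0n // invr_ge0 mulr_ge0 ?ltW.
have d3 : 0 <= ((lam * M) ^+ 2 * n%:R)^-1 * C2.
  by rewrite mulr_ge0 ?ler0n // invr_ge0 mulr_ge0 ?sqr_ge0 ?ltW.
have d4 : 0 <= ((lam * mu) ^+ 2)^-1 * C1 by rewrite mulr_ge0 ?ler0n // invr_ge0 sqr_ge0.
move: lt1; rewrite /defect -/X -/T -/C2 -/C1 => lt1.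
have h1 : 4 / (N * p ^+ 6) ^+ 2 * (X - N * p ^+ 6) ^+ 2 < 1 by lra.
have : (K * mu)^-1 * T < 1 by lra.
rewrite mulrC ltr_pdivrMr ?mulr_gt0 // mul1r => h2.
have : ((lam * M) ^+ 2 * n%:R)^-1 * C2 < 1 by lra.
rewrite mulrC ltr_pdivrMr ?mulr_gt0 ?exprn_gt0 // mul1r => h3.
have : ((lam * mu) ^+ 2)^-1 * C1 < 1 by lra.
rewrite mulrC ltr_pdivrMr ?exprn_gt0 // mul1r => h4.
have h3' : (lam * M)^-1 * C2 <= lam * mu.
  rewrite mulrC ler_pdivrMr // (le_trans (ltW h3)) // muE le_eqVlt; apply/orP; left; apply/eqP; ring.
have h4' : (lam * mu)^-1 * C1 <= lam * mu.
  by rewrite mulrC ler_pdivrMr // (le_trans (ltW h4)) // expr2.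
have few' : X <= 162 * (K * mu) * (4 * (lam * mu)).
  apply: (le_trans few); apply: ler_pM; rewrite ?mulr_ge0 ?ler0n //.
  - rewrite !addr_ge0 // ?mulr_ge0 ?ler0n ?invr_ge0 ?ltW //.
  - by rewrite ler_pM2l // ltW.
  - have -> : lam * M * n%:R = lam * mu by rewrite muE; ring.
    lra.
have X2 : X <= N * p ^+ 6 / 2.
  apply: (le_trans few'); rewrite (_ : 162 * _ * _ = (1296 * K * lam) * mu ^+ 2 / 2); last by field.
  rewrite ler_pM2r ?invr_gt0 //; apply: (@le_trans _ _ (a * mu ^+ 2)).
    by rewrite ler_wpM2r ?sqr_ge0.
  rewrite (_ : a * mu ^+ 2 = a * n%:R ^+ 6 * p ^+ 6); last by rewrite /mu; ring.
  by rewrite ler_wpM2r // exprn_ge0 // ltW.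
move: h1; rewrite mulrAC ltr_pdivrMr ?exprn_gt0 // mul1r.
by move: Np0 X2; set Y := N * p ^+ 6; nra.
Qed.

Lemma expect_defect : expect (pairs n) p defect <=
  4 * 7 ^+ 6 / (a * n%:R) + K^-1 + 576 / (lam ^+ 2 * L) + 192 / (lam ^+ 2 * n%:R).
Proof.
have Lp : 0 < L by apply: lt_le_trans L1.
rewrite /defect !expectD !expectZ; apply: lerD; [apply: lerD; [apply: lerD|]|].
- apply: le_trans (ler_wpM2l _ (variance_hits n0 p01 M1 GP)) _; first by rewrite divr_ge0 ?sqr_ge0.
  rewrite -/N [leLHS](_ : _ = 4 * 7 ^+ 6 * (n%:R ^+ 5 / N)); last first.
    by field; rewrite !gt_eqF.
  rewrite ler_wpM2l ?mulr_ge0 ?exprn_ge0 // ler_pdivrMr // mulrC ler_pdivlMr ?mulr_gt0 //.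
  by rewrite (le_trans _ Ga) // le_eqVlt; apply/orP; left; apply/eqP; ring.
- apply: le_trans (ler_wpM2l _ (expect_htri n p01)) _; first by rewrite invr_ge0 mulr_ge0 ?ltW.
  by rewrite -/mu invfM -mulrA mulVf ?gt_eqF // mulr1.
- rewrite mulrC ler_pdivrMr ?mulr_gt0 ?exprn_gt0 ?mulr_gt0 //.
  have -> : expect (pairs n) p (fun H => (edge_collisions H)%:R) =
      \sum_(kl : 'I_3 * 'I_3 | kl.1 != kl.2)
        expect (pairs n) p (fun H => #|collisions (fun x : triples n => (x kl.1, x kl.2)) H|%:R).
    by rewrite -expect_sum; apply: eq_bigr => H _; rewrite natr_sum.
  apply: (@le_trans _ _ (\sum_(kl : 'I_3 * 'I_3) 64 * mu ^+ 2 / (n%:R * L))).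
    rewrite big_mkcond; apply: ler_sum => -[k l] _ /=; case: ifP => [kl|_]; last first.
      by rewrite divr_ge0 ?mulr_ge0 ?sqr_ge0 ?ltW.
    rewrite ler_pdivlMr ?mulr_gt0 // [leLHS]mulrC.
    apply: (expect_collisions n0 p01 L1 LM) => t x /injectiveP it ix [kk ll].
    have : ([set t k; t l] \subset img t :&: img x).
      apply/fintype.subsetP => v; rewrite !inE => /orP[]/eqP->; rewrite imset_f //=.
        by rewrite kk imset_f.
      by rewrite ll imset_f.
    move=> /subset_leq_card; rewrite cards2 (inj_eq it) kl => c2; split; first exact: ltnW.
    by right.
  rewrite sumr_const card_prod !card_ord -mulr_natl muE le_eqVlt; apply/orP; left; apply/eqP.
  by field; rewrite !gt_eqF.
- rewrite mulrC ler_pdivrMr ?exprn_gt0 ?mulr_gt0 //.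
  have -> : expect (pairs n) p (fun H => (vertex_collisions H)%:R) =
      \sum_(m : 'I_3) expect (pairs n) p (fun H => #|collisions (fun x : triples n => x m) H|%:R).
    by rewrite -expect_sum; apply: eq_bigr => H _; rewrite natr_sum.
  apply: (@le_trans _ _ (\sum_(m : 'I_3) 64 * mu ^+ 2 / n%:R)).
    apply: ler_sum => m _; rewrite ler_pdivlMr // [leLHS]mulrC.
    have := @expect_collisions _ _ _ n0 p01 _ (fun x : triples n => x m) 1 (lexx 1).
    rewrite mulr1 expr1n; apply=> // t x it ix tx; split; last by left.
    by apply/card_gt0P; exists (t m); rewrite inE {2}tx !imset_f.
  rewrite sumr_const card_ord -mulr_natl le_eqVlt; apply/orP; left; apply/eqP.
  by field; rewrite !gt_eqF.
Qed.

Lemma rbw_prob_lower :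
  1 - (4 * 7 ^+ 6 / (a * n%:R) + K^-1 + 576 / (lam ^+ 2 * L) + 192 / (lam ^+ 2 * n%:R))
    <= Gnp_prob p (fun H => rbw_K6 (G :|: H)).
Proof.
apply: (@le_trans _ _ (1 - expect (pairs n) p defect)); first by rewrite lerB // expect_defect.
apply: (proj1 (andP (Gnp_prob_ge p01 _ _))) => [H _|H HP nQ]; first exact: defect_ge0.
by rewrite leNgt; apply/negP => lt1; apply/nQ/defect_lt1.
Qed.

End ManyHits.

Local Open Scope classical_set_scope.

Lemma Gnp_prob_cvg1 (R : realType) (p : nat -> R) (Q : forall n, {set {set 'I_n}} -> Prop) :
  (forall n, 0 <= p n <= 1) ->
  (forall e : R, 0 < e -> \forall n \near \oo, 1 - e <= Gnp_prob (p n) (@Q n)) ->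
  Gnp_prob (p n) (@Q n) @[n --> \oo] --> (1 : R).
Proof.
move=> p01 H; apply/cvgrPdist_le => e e0; near=> n.
have /andP[_ le1] : 1 - expect (pairs n) (p n) (fun=> 1) <= Gnp_prob (p n) (@Q n) <= 1.
  by apply: Gnp_prob_ge.
rewrite ger0_norm ?subr_ge0 // lerBlDl -lerBlDr; near: n; exact: H.
Unshelve. all: by end_near.
Qed.

Lemma powR_slack (R : realType) (L p : R) n : 1 <= L -> 0 <= p ->
  L <= p * n%:R `^ (2 / 3) -> L ^+ 2 <= n%:R ^+ 2 * p ^+ 3.
Proof.
move=> L1 p0 Lp; have L0 : 0 <= L := le_trans ler01 L1.
apply: (@le_trans _ _ (L ^+ 3)); first by rewrite ler_weXn2l.
have e : (n%:R `^ (2 / 3)) ^+ 3 = n%:R ^+ 2 :> R.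
  rewrite -[LHS]powR_mulrn ?powR_ge0 // -powRrM (_ : 2 / 3 * 3%:R = 2%:R); last by field.
  by rewrite powR_mulrn ?ler0n.
rewrite -e mulrC -exprMn.
by rewrite lerXn2r ?nnegrE // (le_trans L0).
Qed.

Lemma rbw_above_threshold (R : realType) (d : R) (p : nat -> R) (G : forall n, {set {set 'I_n}}) :
  0 < d -> (forall n, 0 <= p n <= 1) ->
  (p n * n%:R `^ (2 / 3) @[n --> \oo] --> +oo) ->
  (forall n, dense_graph d (G n)) ->
  Gnp_prob (p n) (fun H => rbw_K6 (G n :|: H)) @[n --> \oo] --> (1 : R).
Proof.
move=> d0 p01 pinf dG; apply: (Gnp_prob_cvg1 (Q := fun n H => rbw_K6 (G n :|: H))) => // e e0.
have [b [b0 bE]] : exists b : R, 0 < b /\ 1296 = b by exists 1296; rewrite ltr0n.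
have [c [c0 cE]] : exists c : R, 0 < c /\ 2304 = c by exists 2304; rewrite ltr0n.
have [a [a0 aE]] : exists a : R, 0 < a /\ (d / 2) ^+ 9 = 2 * a.
  exists ((d / 2) ^+ 9 / 2); split; last by field.
  by apply: divr_gt0; rewrite // exprn_gt0 // divr_gt0.
have [K [K0 KE]] : exists K : R, 0 < K /\ K^-1 = e / 4.
  by exists (4 / e); rewrite invf_div divr_gt0.
have bK : 0 < b * K := mulr_gt0 b0 K0.
have [lam [lam0 lamE]] : exists lam : R, 0 < lam /\ b * K * lam = a.
  by exists (a / (b * K)); split; [exact: divr_gt0 | rewrite mulrC divfK // gt_eqF].
have le0 : 0 < lam ^+ 2 * e by rewrite mulr_gt0 ?exprn_gt0.
have [L [L1 LE]] : exists L : R, 1 <= L /\ lam ^+ 2 * e * L = lam ^+ 2 * e + c.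
  exists (1 + c / (lam ^+ 2 * e)); split; first by rewrite lerDl divr_ge0 // ltW.
  by rewrite mulrDr mulr1 [_ * (c / _)]mulrC divfK // gt_eqF.
have near1 := nbhs_infty_ger (6 / a).
have near2 := nbhs_infty_ger (16 * 7 ^+ 6 / (a * e)).
have near3 := nbhs_infty_ger (768 / (lam ^+ 2 * e)).
have near4 := nbhs_infty_ger (2 : R).
move/cvgryPge: pinf => /(_ L) near5.
near=> n.
have n2 : (1 < n)%N by rewrite -(ler_nat R); near: n.
have nR : (0 : R) < n%:R by rewrite ltr0n ltnW.
have p0 := proj1 (andP (p01 n)).
have LM : L ^+ 2 <= n%:R ^+ 2 * p n ^+ 3 by apply: powR_slack => //; near: n.
have Ga : a * n%:R ^+ 6 <= #|k33 (G n)|%:R.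
  apply: le_trans (k33_lower n2 d0 (dG n)).
  have : 6 / a <= n%:R by near: n.
  rewrite ler_pdivrMr // => h6.
  have : 6 * n%:R ^+ 5 <= n%:R * a * n%:R ^+ 5 by rewrite ler_pM2r ?exprn_gt0.
  by rewrite aE (exprS n%:R 5); lra.
have Klam : 1296 * K * lam <= a by rewrite bE lamE.
apply: le_trans (rbw_prob_lower (ltnW n2) (p01 n) L1 LM a0 K0 lam0 Klam (proj1 (dG n)) Ga).
rewrite lerB //.
have h1 : 4 * 7 ^+ 6 / (a * n%:R) <= e / 4.
  have : 16 * 7 ^+ 6 / (a * e) <= n%:R by near: n.
  rewrite ler_pdivrMr ?mulr_gt0 // ler_pdivrMr ?mulr_gt0 // => h; lra.
have h2 : K^-1 <= e / 4 by rewrite KE.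
have h3 : 576 / (lam ^+ 2 * L) <= e / 4.
  rewrite ler_pdivrMr ?mulr_gt0 ?exprn_gt0 // ?(lt_le_trans ltr01) //.
  by move: le0 LE; rewrite -cE; lra.
have h4 : 192 / (lam ^+ 2 * n%:R) <= e / 4.
  have : 768 / (lam ^+ 2 * e) <= n%:R by near: n.
  rewrite ler_pdivrMr // ler_pdivrMr ?mulr_gt0 ?exprn_gt0 // => h; lra.
lra.
Unshelve. all: by end_near.
Qed.

Lemma not_rbw_below_threshold (R : realType) (d eps : R) : d <= 1 / 2 -> 0 < eps ->
  exists G : forall n : nat, {set {set 'I_n}},
    (forall n, dense_graph d (G n)) /\
    Gnp_prob ((n%:R : R) `^ (- (2 / 3 + eps))) (fun H => ~ rbw_K6 (G n :|: H)) @[n --> \oo] --> (1 : R).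
Proof.
move=> d2 eps0; pose A n := [set i : 'I_n | (i < n./2)%N]%SET.
exists (fun n => cut (A n)); split; first by move=> n; apply: dense_balanced_cut.
have x0 : 0 < 2 / 3 + eps by lra.
have p01 n : 0 <= (n%:R : R) `^ (- (2 / 3 + eps)) <= 1.
  rewrite powR_ge0 /=; case: n => [|n].
    by rewrite powR0 // oppr_eq0 gt_eqF.
  by rewrite -[leRHS](powRr0 n.+1%:R) ler_powR ?ler1n // oppr_le0 ltW.
apply: (Gnp_prob_cvg1 (Q := fun n H => ~ rbw_K6 (cut (A n) :|: H))) => // e e0.
pose K := (Num.bound ((1 + eps) / eps) + 8)%N.
have epsK : 1 + eps <= eps * (K%:R - 2).
  have : (1 + eps) / eps < (Num.bound ((1 + eps) / eps))%:R.
    by apply: archi_boundP; rewrite divr_ge0 ?addr_ge0 ?ltW.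
  rewrite ltr_pdivrMr // /K natrD => h.
  have : 0 <= eps by apply: ltW.
  lra.
pose C : R := (2 ^ (2 ^ K))%:R * K.+1%:R.
have C0 : 0 < C by rewrite mulr_gt0 ?ltr0n ?expn_gt0.
have near1 := nbhs_infty_ger (1 : R).
have near2 := nbhs_infty_ger ((C / e) `^ eps^-1).
near=> n.
have n1 : (0 < n)%N by rewrite -(ler_nat R); near: n.
apply: le_trans (cut_not_rbw_prob n1 _ eps0 epsK (A n) (p01 n)); last first.
  by rewrite /K addnC.
have np : 0 < n%:R `^ eps :> R by apply: powR_gt0; rewrite ltr0n.
rewrite lerB // -/C ler_pdivrMr // mulrC -ler_pdivrMr //.
have Ce : 0 <= C / e by rewrite divr_ge0 ?ltW.
have -> : C / e = ((C / e) `^ eps^-1) `^ eps by rewrite -powRrM mulVf ?lt0r_neq0 // powRr1.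
apply: ge0_ler_powR; [exact: ltW | rewrite nnegrE; exact: powR_ge0 | rewrite nnegrE; exact: ler0n |].
by near: n.
Unshelve. all: by end_near.
Qed.

Theorem theorem1p3 (R : realType) (d : R) (hd0 : 0 < d) (hd1 : d <= 1 / 2) :
  (* (1) *)
  (forall p : nat -> R,
     (forall n, 0 <= p n <= 1) ->
     (p n * (n%:R) `^ (2 / 3) @[n --> \oo] --> +oo) ->
     forall G : forall n : nat, {set {set 'I_n}},
       (forall n, dense_graph d (G n)) ->
       Gnp_prob (p n) (fun H => rbw_K6 (G n :|: H)) @[n --> \oo] --> (1 : R))
  /\
  (* (2) *)
  (forall eps : R, 0 < eps ->
     exists G : forall n : nat, {set {set 'I_n}},
       (forall n, dense_graph d (G n)) /\
       Gnp_prob ((n%:R : R) `^ (- (2 / 3 + eps)))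
                (fun H => ~ rbw_K6 (G n :|: H)) @[n --> \oo] --> (1 : R)).
Proof.
split=> [p p01 pinf G dG|eps eps0]; first exact: (rbw_above_threshold hd0 p01 pinf dG).
exact: not_rbw_below_threshold.
Qed.
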